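(* $\mathrm{MINCC}$ and $\mathrm{MINRC}$ are solvable in polynomial time on instances in which the graph $G=\bigcup\mathcal{P}$ is a tree and there is a vertex $r$ of $G$ that is an endpoint of every path $P\in\mathcal{P}$.
   Context: Let $G$ be a finite undirected graph with maximum degree $\Delta(G)$, and let $X=\{1,\dots,|X|\}$ be a set of colors with $|X|\ge \Delta(G)+1$. A proper edge coloring is a map $\chi:E(G)\to X$ assigning distinct colors to edges sharing an endpoint. A traversal cost function is a map $tc:X^2\to\mathbb{R}_{\ge 0}$ with $tc(i,j)=tc(j,i)$ and $tc(i,i)=0$ for all $i,j\in X$. For a path $P=(e_1,\dots,e_\ell)$ (as a sequence of edges), its traversals are the pairs $(e_i,e_{i+1})$, $1\le i<\ell$; the cost of a traversal $t=(e_i,e_{i+1})$ under $\chi$ is $tc_\chi(t)=tc(\chi(e_i),\chi(e_{i+1}))$, and $tc_\chi(P)=\sum_{t} tc_\chi(t)$ over the traversals of $P$. For a set $\mathcal{P}$ of paths, the reload cost is $rc_\chi(\mathcal{P})=\sum_{P\in\mathcal{P}} tc_\chi(P)$, and the changeover cost is $co_\chi(\mathcal{P})=\sum_{t\in \theta(\mathcal{P})} tc_\chi(t)$, where $\theta(\mathcal{P})$ is the set (without multiplicity) of all traversals of paths in $\mathcal{P}$. Problem $\mathrm{MINRC}$ (resp. $\mathrm{MINCC}$): given a set $\mathcal{P}$ of paths, each of length at least $2$, whose union is the graph $G$, a color set $X$ with $|X|\ge\Delta(G)+1$, and a traversal cost function $tc$ (with arbitrary, unbounded values), find a proper edge coloring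 $\chi:E(G)\to X$ minimizing $rc_\chi(\mathcal{P})$ (resp. $co_\chi(\mathcal{P})$). No bound on the degrees of $G$ is assumed. *)

(* Defs.v *)
From HB Require Import structures.
From mathcomp Require Import all_boot all_order all_algebra.
From mathcomp Require Import reals.

Set Implicit Arguments.
Unset Strict Implicit.
Unset Printing Implicit Defensive.

Import Order.TTheory GRing.Theory Num.Theory.

Local Open Scope nat_scope.

(* A path is given by the sequence of its vertices; edges are two-element     *)
(* vertex sets.                                                               *)
Definition path_edges (V : finType) (p : seq V) : seq {set V} :=
  [seq [set uv.1; uv.2] | uv <- zip p (behead p)].

Definition traversals (V : finType) (p : seq V) : seq ({set V} * {set V}) :=
  zip (path_edges p) (behead (path_edges p)).

Section Graph.
Variables (V : finType) (E : {set {set V}}).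

Definition adj : rel V := fun u v => [set u; v] \in E.

Definition degree (v : V) : nat := #|[set e in E | v \in e]|.

Definition max_degree : nat := \max_(v : V) degree v.

Definition connected_graph : Prop := forall u v : V, connect adj u v.

Definition acyclic : Prop := forall c : seq V, 2 < size c -> ~~ ucycleb adj c.

Definition is_tree : Prop := [/\ 0 < #|V|, connected_graph & acyclic].

(* A coloring is a total function on vertex sets, of which only the values on *)
(* the edges matter.                                                          *)
Definition proper (X : Type) (chi : {set V} -> X) : Prop :=
  forall e f, e \in E -> f \in E -> e != f -> e :&: f != set0 ->
    chi e <> chi f.

End Graph.

Record instance (F : Type) := Instance {
  nvert : nat;
  ncol  : nat;
  paths : seq (seq 'I_nvert);
  tc    : 'I_ncol -> 'I_ncol -> F
}.

Definition vertex F (I : instance F) : finType := 'I_(nvert I).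
Definition color F (I : instance F) : finType := 'I_(ncol I).
Definition coloring F (I : instance F) : Type := {set vertex I} -> color I.

Definition edges F (I : instance F) : {set {set vertex I}} :=
  [set e | has (fun p => e \in path_edges p) (paths I)].

(* theta(P): being a set, it counts each traversal once.                      *)
Definition theta F (I : instance F) :
    {set {set vertex I} * {set vertex I}} :=
  [set t | has (fun p => t \in traversals p) (paths I)].

(* The third condition says that every vertex lies on some path, so that the  *)
(* graph on all of 'I_(nvert I) with edge set (edges I) is the union of the   *)
(* paths.  A path with at least two edges has at least three vertices.        *)
Definition valid (F : numDomainType) (I : instance F) : Prop :=
  [/\ uniq (paths I),
      forall p, p \in paths I -> uniq p /\ 2 < size p,
      forall v : vertex I, has (fun p => v \in p) (paths I),
      max_degree (edges I) + 1 <= ncol I &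
      [/\ forall i j, (0 <= tc (i : color I) j)%R,
          forall i j, tc (i : color I) j = tc j i &
          forall i, tc (i : color I) i = 0%R]].

Section Costs.
Variables (F : numDomainType) (I : instance F) (chi : coloring I).

Definition tcost (t : {set vertex I} * {set vertex I}) : F :=
  tc (chi t.1) (chi t.2).

Definition reload_cost : F :=
  (\sum_(p <- paths I) \sum_(t <- traversals p) tcost t)%R.

Definition changeover_cost : F := (\sum_(t in theta I) tcost t)%R.

End Costs.

Inductive problem := MINRC | MINCC.

Definition cost (F : numDomainType) (pb : problem) (I : instance F)
    (chi : coloring I) : F :=
  match pb with
  | MINRC => reload_cost chi
  | MINCC => changeover_cost chi
  end.

Definition optimal (F : numDomainType) (pb : problem) (I : instance F)
    (chi : coloring I) : Prop :=
  proper (edges I) chi /\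
  forall chi' : coloring I, proper (edges I) chi' ->
    (cost pb chi <= cost pb chi')%R.

Definition is_endpoint (V : eqType) (r : V) (p : seq V) : Prop :=
  ohead p = Some r \/ ohead (rev p) = Some r.

Definition rooted_tree F (I : instance F) : Prop :=
  is_tree (edges I) /\
  exists r : vertex I, forall p, p \in paths I -> is_endpoint r p.

(* Jones's language WHILE on binary trees, whose leaves may moreover hold     *)
(* numbers of an ordered domain F.  Tree cells and atoms are shared, never    *)
(* copied, hence the constant charge for the tree operations.  Numbers can    *)
(* only be added, subtracted and compared; such an operation is charged       *)
(* 1 + w a + w b on operands a and b, where w : F -> nat says how long a      *)
(* number is:                                                                 *)
(* - w = 0 on the real numbers is the unit-cost real-arithmetic model;        *)
(* - w = binary length on the rational numbers is the bit (logarithmic-cost)  *)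
(*   model, which is polynomially equivalent to Turing machines.              *)
(* There is no multiplication, so that on integer costs t steps of the        *)
(* unit-cost model lengthen the numbers by at most t bits.                    *)

Inductive value (F : Type) := Nil | Num of F | Cons of value F & value F.
Arguments Nil {F}.

Inductive expr :=
  | EVar of nat
  | ENil
  | ECons of expr & expr
  | EHd of expr
  | ETl of expr
  | EZero
  | EAdd of expr & expr
  | ESub of expr & expr
  | ELe of expr & expr.

Inductive cmd :=
  | Skip
  | Assign of nat & expr
  | Seq of cmd & cmd
  | If of expr & cmd & cmd
  | While of expr & cmd.

Section Semantics.
Variables (F : numDomainType) (w : F -> nat).

Definition store := nat -> value F.

Definition upd (s : store) (x : nat) (v : value F) : store :=
  fun y => if y == x then v else s y.

Definition vbool (b : bool) : value F := if b then Cons Nil Nil else Nil.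

Definition vtrue (v : value F) : bool := if v is Nil then false else true.

Definition arith (f : F -> F -> value F) (a b : value F) : value F :=
  if (a, b) is (Num x, Num y) then f x y else Nil.

Fixpoint eval (s : store) (e : expr) : value F :=
  match e with
  | EVar x => s x
  | ENil => Nil
  | ECons e1 e2 => Cons (eval s e1) (eval s e2)
  | EHd e1 => if eval s e1 is Cons a _ then a else Nil
  | ETl e1 => if eval s e1 is Cons _ b then b else Nil
  | EZero => Num 0%R
  | EAdd e1 e2 => arith (fun x y => Num (x + y)%R) (eval s e1) (eval s e2)
  | ESub e1 e2 => arith (fun x y => Num (x - y)%R) (eval s e1) (eval s e2)
  | ELe e1 e2 => arith (fun x y => vbool (x <= y)%R) (eval s e1) (eval s e2)
  end.

Definition vlen (v : value F) : nat := if v is Num x then w x else 0.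

Fixpoint ecost (s : store) (e : expr) : nat :=
  match e with
  | EVar _ | ENil | EZero => 1
  | ECons e1 e2 => (ecost s e1 + ecost s e2).+1
  | EHd e1 | ETl e1 => (ecost s e1).+1
  | EAdd e1 e2 | ESub e1 e2 | ELe e1 e2 =>
      (ecost s e1 + ecost s e2 + vlen (eval s e1) + vlen (eval s e2)).+1
  end.

(* exec c s t s' : started in store s, the command c halts in time t with     *)
(* final store s'.                                                            *)
Inductive exec : cmd -> store -> nat -> store -> Prop :=
  | exec_skip s : exec Skip s 1 s
  | exec_assign s x e :
      exec (Assign x e) s (ecost s e).+1 (upd s x (eval s e))
  | exec_seq c1 c2 s s1 s2 t1 t2 :
      exec c1 s t1 s1 -> exec c2 s1 t2 s2 ->
      exec (Seq c1 c2) s (t1 + t2).+1 s2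
  | exec_if_true e c1 c2 s s1 t :
      vtrue (eval s e) -> exec c1 s t s1 ->
      exec (If e c1 c2) s (ecost s e + t).+1 s1
  | exec_if_false e c1 c2 s s1 t :
      ~~ vtrue (eval s e) -> exec c2 s t s1 ->
      exec (If e c1 c2) s (ecost s e + t).+1 s1
  | exec_while_true e c s s1 s2 t1 t2 :
      vtrue (eval s e) -> exec c s t1 s1 -> exec (While e c) s1 t2 s2 ->
      exec (While e c) s (ecost s e + t1 + t2).+1 s2
  | exec_while_false e c s :
      ~~ vtrue (eval s e) -> exec (While e c) s (ecost s e).+1 s.

Definition input_store (v : value F) : store :=
  fun x => if x == 0 then v else Nil.

(* Variable 0 holds the input at the start and the output at the end.         *)
Definition run (c : cmd) (input : value F) (t : nat) (output : value F) :
    Prop :=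
  exists s, exec c (input_store input) t s /\ s 0 = output.

End Semantics.

Section Encoding.
Variable F : numDomainType.

Definition enc_list (l : seq (value F)) : value F := foldr (@Cons F) Nil l.

(* Vertices and colors are written in unary; this is harmless because         *)
(* instance_size below does not depend on how they are written.               *)
Definition enc_nat (n : nat) : value F := enc_list (nseq n Nil).

Definition enc_instance (I : instance F) : value F :=
  enc_list
    [:: enc_nat (nvert I);
        enc_nat (ncol I);
        enc_list [seq enc_list [seq enc_nat (val v) | v <- p] | p <- paths I];
        enc_list [seq enc_list [seq Num (tc i j) | j <- enum (color I)]
                 | i <- enum (color I)]].

(* v lists, in some order, each edge uv of the graph exactly once, as the     *)
(* triple (u, v, color of uv).                                                *)
Definition encodes_coloring (I : instance F) (v : value F) (chi : coloring I) :
    Prop :=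
  exists s : seq (vertex I * vertex I),
    [/\ uniq [seq [set uv.1; uv.2] | uv <- s],
        [seq [set uv.1; uv.2] | uv <- s] =i edges I &
        v = enc_list
              [seq enc_list [:: enc_nat (val uv.1); enc_nat (val uv.2);
                                enc_nat (val (chi [set uv.1; uv.2]))]
              | uv <- s]].

Definition instance_size (w : F -> nat) (I : instance F) : nat :=
  nvert I + ncol I + \sum_(p <- paths I) size p
  + \sum_(i : color I) \sum_(j : color I) (w (tc i j)).+1.

Definition poly_time_solvable (w : F -> nat) (pb : problem)
    (cls : instance F -> Prop) : Prop :=
  exists (c : cmd) (p : {poly nat}),
    forall I : instance F, valid I -> cls I ->
      exists (t : nat) (out : value F) (chi : coloring I),
        [/\ run w c (enc_instance I) t out,
            t <= p.[instance_size w I]%R,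
            encodes_coloring out chi &
            optimal pb chi].

End Encoding.

Definition unit_length (F : Type) (x : F) : nat := 0.

Definition nat_bits (n : nat) : nat := (trunc_log 2 n).+1.

(* One more bit for the sign.                                                 *)
Definition rat_bits (q : rat) : nat :=
  (nat_bits `|numq q|%N + nat_bits `|denq q|%N).+1.

(* Main.v *)
Require Import Defs.
From HB Require Import structures.
From mathcomp Require Import all_boot all_order all_algebra.
From mathcomp Require Import reals.
From mathcomp Require Import zify ring.
From mathcomp Require boolp.

(* Root the tree at r.  Every traversal joins the edge above some vertex v to *)
(* the edge above a child of v, so the cost is a sum over the edges of a      *)
(* function of the colors of an edge and of its parent edge.  Let B v i be    *)
(* the least cost of the edges below v when the edge above v has color i.     *)
(* Then B v i is the value of an assignment problem, in which the children of *)
(* v receive distinct colors different from i, and which the Hungarian method *)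
(* solves.  There is always a solution, as there are more colors than         *)
(* children; an optimal coloring is read off from the root downwards.         *)
(*                                                                            *)
(* For the running time, the algorithm is a term of a small total language    *)
(* whose loops perform at most n + 1 iterations, where n is the number of     *)
(* vertices, colors and paths: compiled to WHILE, such a term takes           *)
(* polynomial time at unit cost.  On rational inputs, all numbers occurring   *)
(* in the first t steps have a common denominator D and numerators at most    *)
(* 2 ^ (k + t), with k and log D linear in the size of the input; hence the   *)
(* bit cost is polynomial as well.                                            *)

Set Implicit Arguments.
Unset Strict Implicit.
Unset Printing Implicit Defensive.

Import Order.TTheory GRing.Theory Num.Theory.

Local Open Scope nat_scope.

(** * Polynomially bounded functions *)

(** In a tree, all simple paths from the root r that go on to a vertex x reach it from the same
    neighbor [parent x] ([unique_pred]). So the edges correspond to the nonroot vertices x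
    ([edgesP], [pedge_inj]), and a traversal pairs the edge of x with that of its parent. Both
    objectives thus become sums over x of a nonnegative term in the colors of x and [parent x]; the
    choice of problem enters only through the multiplicity [weight] ([sum_reload],
    [sum_changeover]). Properness becomes a condition on parent-child and sibling pairs
    ([proper_star]).

    Once the color at v is fixed, the subtrees below the children of v interact only through the
    distinctness of the children's colors. The best extension is therefore a minimum-cost
    assignment, which stays polynomial for unbounded degrees. [assignmentP] certifies the Hungarian
    method by linear programming duality, and [colors_optimal] adds up the resulting Bellman
    equations.

    Complexity is kept apart from correctness. [solve] is a function using bounded loops only,
    [t_solveE] identifies it with the denotation of a term, and [compile_correct] bounds the
    unit-cost time of any compiled term by a polynomial in the fuel. For rational costs,
    [exec_transfer] replays the same run at bit cost, because over a common denominator t additions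
    and subtractions lengthen numerators by at most t bits. *)

Definition poly_bounded (f : nat -> nat) : Prop :=
  exists k, forall n, f n <= (n + 2) ^ k.

Lemma poly_bounded_cst c : poly_bounded (fun=> c).
Proof.
exists c => n; apply: leq_trans (ltnW (ltn_expl c (isT : 1 < 2))) _.
by case: c => // c; rewrite leq_exp2r // leq_addl.
Qed.

Lemma poly_bounded_id : poly_bounded id.
Proof. by exists 1 => n; rewrite expn1 leq_addr. Qed.

Lemma poly_boundedD f g :
  poly_bounded f -> poly_bounded g -> poly_bounded (fun n => f n + g n).
Proof.
move=> [k fk] [l gl]; exists (maxn k l).+1 => n.
rewrite expnS mulnDl; apply: leq_trans (leq_addl _ _).
rewrite mul2n -addnn leq_add //.
  by apply: leq_trans (fk n) _; rewrite leq_exp2l ?leq_maxl // addn2.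
by apply: leq_trans (gl n) _; rewrite leq_exp2l ?leq_maxr // addn2.
Qed.

Lemma poly_boundedM f g :
  poly_bounded f -> poly_bounded g -> poly_bounded (fun n => f n * g n).
Proof.
move=> [k fk] [l gl]; exists (k + l) => n.
by rewrite expnD leq_mul.
Qed.

Lemma poly_boundedS f : poly_bounded f -> poly_bounded (fun n => (f n).+1).
Proof.
move=> pf; have [k fk] := poly_boundedD (poly_bounded_cst 1) pf.
by exists k.
Qed.

(** * A total language with fuel-bounded loops *)

(* The index type stands for {0, ..., n}, where n.+1 is the fuel.             *)
Inductive ty :=
  | TUnit | TBool | TIdx | TNum
  | TPair of ty & ty | TTab of ty | TList of ty.

Inductive op : ty -> ty -> Type :=
  | OId A : op A A
  | OFst A B : op (TPair A B) A
  | OSnd A B : op (TPair A B) B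
  | OUnit A : op A TUnit
  | OTrue A : op A TBool
  | OFalse A : op A TBool
  | OIdx0 A : op A TIdx
  | ONil A B : op A (TList B)
  | OCons A : op (TPair A (TList A)) (TList A)
  | OZero A : op A TNum
  | OAdd : op (TPair TNum TNum) TNum
  | OSub : op (TPair TNum TNum) TNum
  | OLe : op (TPair TNum TNum) TBool.

(* A term [t : tm A B] is a program with environment [A] and result [B]. *)
Inductive tm : ty -> ty -> Type :=
  | Op A B : op A B -> tm A B
  | Comp A B C : tm A B -> tm B C -> tm A C
  | Pair A B C : tm A B -> tm A C -> tm A (TPair B C)
  | Ite A B : tm A TBool -> tm A B -> tm A B -> tm A B
  | LCase A B C : tm A (TList B) -> tm A C ->
      tm (TPair B (TPair (TList B) A)) C -> tm A C
  | Loop A B : tm A B -> tm (TPair TIdx (TPair B A)) B -> tm A B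
  | Tab A B : tm (TPair TIdx A) B -> tm A (TTab B)
  | Get B : tm (TPair (TTab B) TIdx) B
  | Leq : tm (TPair TIdx TIdx) TBool.

Section Denotation.
Variables (F : numDomainType) (n : nat).

Fixpoint sem (A : ty) : Type :=
  match A with
  | TUnit => unit
  | TBool => bool
  | TIdx => 'I_n.+1
  | TNum => F
  | TPair A B => sem A * sem B
  | TTab A => 'I_n.+1 -> sem A
  | TList A => seq (sem A)
  end.

(** A pair is a bare [Cons] and the unit is [Nil], so nested pairs ending in [TUnit] are represented
    as lists. This makes the representation of the input coincide with [enc_instance]. *)
Fixpoint vof (A : ty) : sem A -> value F :=
  match A with
  | TUnit => fun=> Defs.Nil
  | TBool => @vbool F
  | TIdx => fun i => enc_nat F i
  | TNum => @Defs.Num F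
  | TPair A B => fun x => Defs.Cons (vof x.1) (vof x.2)
  | TTab A => fun f => enc_list [seq vof (f i) | i <- enum 'I_n.+1]
  | TList A => fun l => enc_list [seq vof x | x <- l]
  end.

Definition den_op A B (o : op A B) : sem A -> sem B :=
  match o with
  | OId _ => id
  | OFst _ _ => fst
  | OSnd _ _ => snd
  | OUnit _ => fun=> tt
  | OTrue _ => fun=> true
  | OFalse _ => fun=> false
  | OIdx0 _ => fun=> ord0
  | ONil _ _ => fun=> [::]
  | OCons _ => fun x => x.1 :: x.2
  | OZero _ => fun=> 0%R
  | OAdd => fun x => (x.1 + x.2)%R
  | OSub => fun x => (x.1 - x.2)%R
  | OLe => fun x => (x.1 <= x.2)%R
  end.

(** Loops run from index n down to 0, the order in which a unary counter that is decremented before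
    each pass supplies the indices. *)
Fixpoint den A B (t : tm A B) : sem A -> sem B :=
  match t with
  | Op _ _ o => den_op o
  | Comp _ _ _ f g => fun a => den g (den f a)
  | Pair _ _ _ f g => fun a => (den f a, den g a)
  | Ite _ _ c f g => fun a => if den c a then den f a else den g a
  | LCase _ _ _ l f g => fun a =>
      match den l a with [::] => den f a | x :: l' => den g (x, (l', a)) end
  | Loop _ _ f g => fun a =>
      foldr (fun i acc => den g (i, (acc, a))) (den f a) (enum 'I_n.+1)
  | Tab _ _ f => fun a i => den f (i, a)
  | Get _ => fun x => x.1 x.2
  | Leq => fun x => x.1 <= x.2
  end.

End Denotation.

(** [OCons] compiles to the identity, because a pair and a nonempty list have the same
    representation. *)
Definition op_expr A B (o : op A B) (d : nat) : expr :=
  match o with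
  | OId _ => EVar d
  | OFst _ _ => EHd (EVar d)
  | OSnd _ _ => ETl (EVar d)
  | OUnit _ => ENil
  | OTrue _ => ECons ENil ENil
  | OFalse _ => ENil
  | OIdx0 _ => ENil
  | ONil _ _ => ENil
  | OCons _ => EVar d
  | OZero _ => EZero
  | OAdd => EAdd (EHd (EVar d)) (ETl (EVar d))
  | OSub => ESub (EHd (EVar d)) (ETl (EVar d))
  | OLe => ELe (EHd (EVar d)) (ETl (EVar d))
  end.

Definition foreach (d : nat) (c : cmd) : cmd :=
  Seq (Assign d.+2 (EVar 0))
    (While (EVar d.+2) (Seq (Assign d.+2 (ETl (EVar d.+2))) c)).

(** Serves both indexing and comparison: a unary index i is itself a list, and dropping j of its
    cells leaves nothing exactly when i <= j. *)
Definition drop_cmd (d : nat) : cmd :=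
  Seq (Assign d.+1 (EHd (EVar d)))
 (Seq (Assign d.+2 (ETl (EVar d)))
      (While (EVar d.+2)
         (Seq (Assign d.+1 (ETl (EVar d.+1)))
              (Assign d.+2 (ETl (EVar d.+2)))))).

(* Variable 0 holds the fuel; [compile t d] replaces the environment in       *)
(* variable d by the result and leaves the variables below d unchanged.       *)
Fixpoint compile A B (t : tm A B) (d : nat) : cmd :=
  match t with
  | Op _ _ o => Assign d (op_expr o d)
  | Comp _ _ _ f g => Seq (compile f d) (compile g d)
  | Pair _ _ _ f g =>
      Seq (Assign d.+1 (EVar d)) (Seq (compile f d.+1)
     (Seq (Assign d.+2 (EVar d)) (Seq (compile g d.+2)
          (Assign d (ECons (EVar d.+1) (EVar d.+2))))))
  | Ite _ _ c f g =>
      Seq (Assign d.+1 (EVar d)) (Seq (compile c d.+1)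
          (If (EVar d.+1) (compile f d) (compile g d)))
  | LCase _ _ _ l f g =>
      Seq (Assign d.+1 (EVar d)) (Seq (compile l d.+1)
          (If (EVar d.+1)
             (Seq (Assign d (ECons (EHd (EVar d.+1))
                                   (ECons (ETl (EVar d.+1)) (EVar d))))
                  (compile g d))
             (compile f d)))
  | Loop _ _ f g =>
      Seq (Assign d.+1 (EVar d)) (Seq (compile f d.+1)
     (Seq (foreach d
             (Seq (Assign d.+3 (ECons (EVar d.+2)
                                      (ECons (EVar d.+1) (EVar d))))
             (Seq (compile g d.+3) (Assign d.+1 (EVar d.+3)))))
          (Assign d (EVar d.+1))))
  | Tab _ _ f =>
      Seq (Assign d.+1 ENil)
     (Seq (foreach d
             (Seq (Assign d.+3 (ECons (EVar d.+2) (EVar d)))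
             (Seq (compile f d.+3)
                  (Assign d.+1 (ECons (EVar d.+3) (EVar d.+1))))))
          (Assign d (EVar d.+1)))
  | Get _ => Seq (drop_cmd d) (Assign d (EHd (EVar d.+1)))
  | Leq => Seq (drop_cmd d)
             (If (EVar d.+1) (Assign d ENil) (Assign d (ECons ENil ENil)))
  end.

(** * Correctness and unit-cost time of compiled terms *)

Section CompileCorrect.
Variable F : numDomainType.
Local Notation store := (store F).
Local Notation w0 := (@unit_length F).

(** Total correctness with a time budget. At unit cost the price of an expression depends on its
    syntax alone, so budgets can be added up without looking at the store. *)
Definition wp (c : cmd) (b : nat) (Q : store -> Prop) (s : store) : Prop :=
  exists t s', [/\ exec w0 c s t s', t <= b & Q s'].

Lemma wp_assign x e b (Q : store -> Prop) s :
  ecost w0 s e < b -> Q (upd s x (eval s e)) -> wp (Assign x e) b Q s.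
Proof.
move=> le_b Qs; exists (ecost w0 s e).+1, (upd s x (eval s e)).
by split=> //; constructor.
Qed.

Lemma wp_seq c1 c2 b1 b2 b (Q : store -> Prop) s :
  (b1 + b2).+1 <= b -> wp c1 b1 (wp c2 b2 Q) s -> wp (Seq c1 c2) b Q s.
Proof.
move=> le_b [t1 [s1 [ex1 le1 [t2 [s2 [ex2 le2 Qs]]]]]].
exists (t1 + t2).+1, s2; split=> //; first exact: exec_seq ex1 ex2.
by apply: leq_trans le_b; rewrite ltnS leq_add.
Qed.

Lemma wp_if x c1 c2 b1 b2 b (Q : store -> Prop) s :
  (maxn b1 b2).+2 <= b ->
  (if vtrue (s x) then wp c1 b1 Q s else wp c2 b2 Q s) ->
  wp (If (EVar x) c1 c2) b Q s.
Proof.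
move=> le_b; case: ifP => [tx|/negbT fx] [t [s1 [ex1 le1 Qs]]].
- exists (1 + t).+1, s1; split=> //; first exact: exec_if_true.
  by apply: leq_trans le_b; rewrite !ltnS leq_max le1.
- exists (1 + t).+1, s1; split=> //; first exact: exec_if_false.
  by apply: leq_trans le_b; rewrite !ltnS leq_max le1 orbT.
Qed.

Lemma wp_while x c b (Inv : nat -> store -> Prop) :
  (forall s, Inv 0 s -> ~~ vtrue (s x)) ->
  (forall m s, Inv m.+1 s -> vtrue (s x) /\ wp c b (Inv m) s) ->
  forall m s, Inv m s -> wp (While (EVar x) c) (m * b.+2).+2 (Inv 0) s.
Proof.
move=> Inv0 InvS; elim=> [|m IHm] s Is.
  exists 2, s; split=> //; first exact/exec_while_false/Inv0.
have [tx [t1 [s1 [ex1 le1 /IHm[t2 [s2 [ex2 le2 Is2]]]]]]] := InvS _ _ Is.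
exists (1 + t1 + t2).+1, s2; split=> //.
  exact: exec_while_true ex1 ex2.
by rewrite mulSn; lia.
Qed.

Lemma wp_weaken c b b' (Q Q' : store -> Prop) s :
  wp c b Q s -> b <= b' -> (forall s', Q s' -> Q' s') -> wp c b' Q' s.
Proof.
move=> [t [s' [ex le Qs]]] leb QQ'; exists t, s'; split=> //.
  exact: leq_trans leb.
exact: QQ'.
Qed.

Definition frame (d : nat) (s s' : store) : Prop :=
  forall x, x < d -> s' x = s x.

Lemma updE (s : store) x v y : upd s x v y = if y == x then v else s y.
Proof. by []. Qed.

Ltac upds := rewrite ?updE ?eqxx //=; repeat (case: eqP => [?|_]; try lia).

Lemma vtrue_enc_nat k : vtrue (enc_nat F k) = (0 < k).
Proof. by case: k. Qed.

(** [Inv m] describes the state in which the indices from m upwards have been processed; it may not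
    refer to the counter, as the first hypothesis on [Inv] says. *)
Lemma wp_foreach d c b k (Inv : nat -> store -> Prop) s :
  s 0 = enc_nat F k ->
  (forall m s s', Inv m s -> (forall x, x != d.+2 -> s' x = s x) -> Inv m s') ->
  (forall m s, m < k -> Inv m.+1 s -> s d.+2 = enc_nat F m ->
     wp c b (fun s' => Inv m s' /\ s' d.+2 = enc_nat F m) s) ->
  Inv k s ->
  wp (foreach d c) (k * (b + 6) + 5) (Inv 0) s.
Proof.
move=> s0 Inv_frame step Ik.
apply: (@wp_seq _ _ 2 (k * (b + 4).+2).+2); first by lia.
apply: wp_assign => //=; rewrite s0.
pose J m (s' : store) := [/\ m <= k, Inv m s' & s' d.+2 = enc_nat F m].
have J_k : J k (upd s d.+2 (enc_nat F k)).
  split; rewrite // ?updE ?eqxx //.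
  by apply: Inv_frame Ik _ => x /negPf; rewrite updE => ->.
apply: (@wp_weaken _ (k * (b + 4).+2).+2 _ (J 0)) => //; last by move=> s' [].
apply: wp_while J_k => [s' [_ _ ->] //|m s' [ltmk Im s'd]].
rewrite s'd; split=> //.
apply: (@wp_seq _ _ 3 b (b + 4)) => //; first by lia.
apply: wp_assign => //=; rewrite s'd /=.
apply: (@wp_weaken _ b _ (fun s' => Inv m s' /\ s' d.+2 = enc_nat F m)) => //.
  apply: step => //; last by rewrite updE eqxx.
  by apply: Inv_frame Im _ => x /negPf; rewrite updE => ->.
by move=> s'' [? ?]; split=> //; apply: ltnW.
Qed.

Lemma wp_drop d (l : seq (value F)) k (s : store) :
  s d = Defs.Cons (enc_list l) (enc_nat F k) ->
  wp (drop_cmd d) (k * 9 + 20)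
    (fun s' => s' d.+1 = enc_list (drop k l) /\ frame d s s') s.
Proof.
move=> sd; apply: (@wp_seq _ _ 3 (k * 9 + 10)) => //; first by lia.
apply: wp_assign => //=; rewrite sd.
apply: (@wp_seq _ _ 3 (k * 9 + 2)) => //; first by lia.
apply: wp_assign => //=; rewrite updE ltn_eqF // sd.
pose J m (s' : store) := exists2 j, m + j = k &
  [/\ s' d.+1 = enc_list (drop j l), s' d.+2 = enc_nat F m & frame d s s'].
apply: (@wp_weaken _ (k * 9).+2 _ (J 0)); last 2 first.
- by lia.
- by move=> s' [j <- []].
apply: wp_while; last first.
- exists 0; rewrite ?addn0 // drop0; split; [by upds| by upds|].
  by move=> x ltxd; upds.
- move=> m s' [j jk [s'1 s'2 fr]]; rewrite s'2; split=> //.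
  apply: (@wp_seq _ _ 3 3) => //; apply: wp_assign => //=.
  apply: wp_assign => //=; exists j.+1; first by lia.
  split.
  + upds; rewrite s'1 -add1n -drop_drop.
    by case: (drop j l) => //= ? ?; rewrite drop0.
  + by upds; rewrite s'2.
  + by move=> x ltxd; upds; apply: fr.
- by move=> s' [j _ [_ -> _]].
Qed.

Lemma enum_ord_drop (n m : nat) (lt_m : m < n) :
  drop m (enum 'I_n) = Ordinal lt_m :: drop m.+1 (enum 'I_n).
Proof.
rewrite (drop_nth (Ordinal lt_m)) ?size_enum_ord //; congr (_ :: _).
by apply: val_inj; rewrite /= nth_enum_ord.
Qed.

(** The time bound depends neither on the argument nor on the size of the values involved. The
    condition [0 < d] protects the fuel in variable 0. *)
Definition computes (n d : nat) A B (t : tm A B) (b : nat) : Prop :=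
  forall (s : store) (a : sem F n A),
    s 0 = enc_nat F n.+1 -> 0 < d -> s d = vof a ->
    wp (compile t d) b (fun s' => s' d = vof (den t a) /\ frame d s s') s.

Lemma computes_op n d A B (o : op A B) : computes n d (Op o) 8.
Proof.
move=> s a _ _; case: o a => /= *; apply: wp_assign => //=.
all: try (by split=> [|x ltxd]; upds).
all: match goal with H : _ = _ |- _ => rewrite ?H //= end.
all: by split=> [|x ltxd]; upds.
Qed.

Lemma wp_call n d A B (t : tm A B) (a : sem F n A) b (Q : store -> Prop) s :
  computes n d t b -> s 0 = enc_nat F n.+1 -> 0 < d -> s d = vof a ->
  (forall s', s' d = vof (den t a) -> frame d s s' -> Q s') ->
  wp (compile t d) b Q s.
Proof.
move=> Ht s0 d0 sd QQ; apply: wp_weaken (Ht s a s0 d0 sd) (leqnn _) _.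
by move=> s' [s'd fr]; apply: QQ.
Qed.

(** By induction on the term: a loop multiplies the time of its body by n + 1 up to constants, and
    the nesting depth is fixed by the term, so the bounds stay polynomial. *)
Lemma compile_correct A B (t : tm A B) :
  exists2 b, poly_bounded b & forall n d, computes n d t (b n).
Proof.
have framed0 d (s s' : store) : 0 < d -> frame d s s' -> s' 0 = s 0.
  by move=> d0; apply.
elim: t => {A B}.
- move=> A B o; exists (fun=> 8); first exact: poly_bounded_cst.
  by move=> n d; apply: computes_op.
- move=> A B C f [bf pf Hf] g [bg pg Hg].
  exists (fun n => (bf n + bg n).+1).
    exact/poly_boundedS/poly_boundedD.
  move=> n d s a s0 d0 sd /=; apply: wp_seq (leqnn _) _.
  apply: wp_weaken (Hf n d s a s0 d0 sd) _ _ => // s1 [s1d fr1].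
  apply: wp_weaken (Hg n d s1 _ _ d0 s1d) _ _ => //.
    by rewrite (framed0 _ _ _ d0 fr1).
  by move=> s2 [-> fr2]; split=> // x ltxd; rewrite fr2 // fr1.
- move=> A B C f [bf pf Hf] g [bg pg Hg].
  exists (fun n => bf n + bg n + 20).
    by apply: poly_boundedD (poly_boundedD _ _) (poly_bounded_cst 20).
  move=> n d s a s0 d0 sd /=.
  apply: (@wp_seq _ _ 2 (bf n + bg n + 17)); first by lia.
  apply: wp_assign => //=.
  apply: (@wp_seq _ _ (bf n) (bg n + 16)); first by lia.
  apply: (wp_call (a := a) (Hf n d.+1)) => //; first by upds.
  move=> s1 s1d fr1.
  apply: (@wp_seq _ _ 2 (bg n + 13)); first by lia.
  apply: wp_assign => //=.
  apply: (@wp_seq _ _ (bg n) 12); first by lia.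
  apply: (wp_call (a := a) (Hg n d.+2)) => //.
  - by rewrite updE /= fr1 // updE /= s0.
  - by upds; rewrite fr1 // updE ltn_eqF.
  move=> s2 s2d fr2; apply: wp_assign => //=; split.
    by rewrite updE eqxx s2d fr2 // updE ltn_eqF // s1d.
  move=> x ltxd; rewrite updE ltn_eqF // fr2 ?updE; last by lia.
  by rewrite ltn_eqF ?fr1 ?updE ?ltn_eqF //; lia.
- move=> A B c [bc pc Hc] f [bf pf Hf] g [bg pg Hg].
  exists (fun n => bc n + bf n + bg n + 20).
    apply: poly_boundedD (poly_bounded_cst _).
    exact: poly_boundedD (poly_boundedD _ _) _.
  move=> n d s a s0 d0 sd /=.
  apply: (@wp_seq _ _ 2 (bc n + bf n + bg n + 10)); first by lia.
  apply: wp_assign => //=.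
  apply: (@wp_seq _ _ (bc n) (bf n + bg n + 8)); first by lia.
  apply: (wp_call (a := a) (Hc n d.+1)) => //; first by upds.
  move=> s1 s1d fr1.
  have fr : frame d s s1.
    by move=> x ltxd; rewrite fr1 ?updE ?ltn_eqF //; lia.
  have s1D : s1 d = vof a by rewrite fr1 // updE ltn_eqF.
  have s10 : s1 0 = enc_nat F n.+1 by rewrite fr.
  apply: (@wp_if _ _ _ (bf n) (bg n)); first by lia.
  rewrite s1d /=; case: (den c a) => /=.
    apply: wp_weaken (Hf n d s1 a s10 d0 s1D) _ _ => // s2 [-> fr2].
    by split=> // x ltxd; rewrite fr2 // fr.
  apply: wp_weaken (Hg n d s1 a s10 d0 s1D) _ _ => // s2 [-> fr2].
  by split=> // x ltxd; rewrite fr2 // fr.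
- move=> A B C c [bc pc Hc] f [bf pf Hf] g [bg pg Hg].
  exists (fun n => bc n + bf n + bg n + 30).
    apply: poly_boundedD (poly_bounded_cst _).
    exact: poly_boundedD (poly_boundedD _ _) _.
  move=> n d s a s0 d0 sd /=.
  apply: (@wp_seq _ _ 2 (bc n + bf n + bg n + 20)); first by lia.
  apply: wp_assign => //=.
  apply: (@wp_seq _ _ (bc n) (bf n + bg n + 18)); first by lia.
  apply: (wp_call (a := a) (Hc n d.+1)) => //; first by upds.
  move=> s1 s1d fr1.
  have fr : frame d s s1.
    by move=> x ltxd; rewrite fr1 ?updE ?ltn_eqF //; lia.
  have s1D : s1 d = vof a by rewrite fr1 // updE ltn_eqF.
  have s10 : s1 0 = enc_nat F n.+1 by rewrite fr.
  apply: (@wp_if _ _ _ (bg n + 12) (bf n)); first by lia.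
  rewrite s1d /=; case: (den c a) s1d => /= [_|x l s1d].
    apply: wp_weaken (Hf n d s1 a s10 d0 s1D) _ _ => // s2 [-> fr2].
    by split=> // x ltxd; rewrite fr2 // fr.
  apply: (@wp_seq _ _ 10 (bg n)); first by lia.
  apply: wp_assign => //=.
  apply: (@wp_call n d (TPair B (TPair (TList B) A)) _ _ (x, (l, a)) _ _ _
    (Hg n d)) => //.
  - by rewrite updE ltn_eqF.
  - by rewrite updE eqxx s1d s1D.
  move=> s2 -> fr2; split=> // y ltyd.
  by rewrite fr2 // updE ltn_eqF // fr.
- move=> A B f [bf pf Hf] g [bg pg Hg].
  exists (fun n => bf n + n.+1 * (bg n + 17) + 20).
    apply: poly_boundedD (poly_boundedD pf _) (poly_bounded_cst _).
    apply: poly_boundedM (poly_boundedS poly_bounded_id) _.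
    exact: poly_boundedD (poly_bounded_cst _).
  move=> n d s a s0 d0 sd /=.
  apply: (@wp_seq _ _ 2 (bf n + n.+1 * (bg n + 17) + 17)); first by lia.
  apply: wp_assign => //=.
  apply: (@wp_seq _ _ (bf n) (n.+1 * (bg n + 17) + 16)); first by lia.
  apply: (wp_call (a := a) (Hf n d.+1)) => //; first by upds.
  move=> s1 s1d fr1.
  have fr : frame d s s1.
    by move=> x ltxd; rewrite fr1 ?updE ?ltn_eqF //; lia.
  have s1D : s1 d = vof a by rewrite fr1 // updE ltn_eqF.
  have s10 : s1 0 = enc_nat F n.+1 by rewrite fr.
  (* The accumulator once the indices n, ..., m have been processed. *)
  pose acc m := foldr (fun i acc => den g (i, (acc, a))) (den f a)
                  (drop m (enum 'I_n.+1)).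
  pose Inv m (s' : store) :=
    [/\ s' d.+1 = vof (acc m), s' d = vof a & frame d s s'].
  apply: (@wp_seq _ _ (n.+1 * (bg n + 17) + 5) 2); first by lia.
  have Inv_n : Inv n.+1 s1.
    by split=> //; rewrite /acc drop_oversize ?size_enum_ord.
  have -> : bg n + 17 = bg n + 11 + 6 by lia.
  apply: wp_weaken (wp_foreach s10 _ _ Inv_n) (leqnn _) _.
  + move=> m s2 s3 [s2d s2D fr2] eqs; split.
    * by rewrite eqs // neq_ltn ltnSn.
    * by rewrite eqs // neq_ltn ltnS leqnSn.
    * by move=> x ltxd; rewrite eqs ?fr2 //; apply/eqP; lia.
  + move=> m s2 ltm [s2d s2D fr2] s2i.
    apply: (@wp_seq _ _ 6 (bg n + 4)); first by lia.
    apply: wp_assign => //=.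
    apply: (@wp_seq _ _ (bg n) 2); first by lia.
    apply: (@wp_call n d.+3 (TPair TIdx (TPair B A)) _ _
      (Ordinal ltm, (acc m.+1, a)) _ _ _ (Hg n d.+3)) => //.
    * by rewrite updE /= fr2.
    * by rewrite updE eqxx s2i s2d s2D.
    * move=> s3 s3d fr3; apply: wp_assign => //=; (split; first split).
      - by rewrite updE eqxx s3d /acc (enum_ord_drop ltm).
      - by rewrite updE ltn_eqF // fr3 ?updE ?ltn_eqF //; lia.
      - by move=> x ltxd; upds; rewrite fr3 ?updE ?ltn_eqF ?fr2 //; lia.
      - by upds; rewrite fr3 ?updE ?ltn_eqF //; lia.
  + move=> s2 [s2d s2D fr2]; apply: wp_assign => //=; split.
      by rewrite updE eqxx s2d /acc drop0.
    by move=> x ltxd; rewrite updE ltn_eqF // fr2.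
- move=> A B f [bf pf Hf].
  exists (fun n => n.+1 * (bf n + 17) + 20).
    apply: poly_boundedD (poly_bounded_cst _).
    apply: poly_boundedM (poly_boundedS poly_bounded_id) _.
    exact: poly_boundedD (poly_bounded_cst _).
  move=> n d s a s0 d0 sd /=.
  apply: (@wp_seq _ _ 2 (n.+1 * (bf n + 17) + 17)); first by lia.
  apply: wp_assign => //=.
  pose acc m := enc_list [seq vof (den f (i, a)) | i <- drop m (enum 'I_n.+1)].
  pose Inv m (s' : store) :=
    [/\ s' d.+1 = acc m, s' d = vof a & frame d s s'].
  apply: (@wp_seq _ _ (n.+1 * (bf n + 17) + 5) 2); first by lia.
  have Inv_n : Inv n.+1 (upd s d.+1 Defs.Nil).
    split; last by move=> x ltxd; upds.
    - by rewrite /acc drop_oversize ?size_enum_ord // updE eqxx.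
    - by upds.
  have -> : bf n + 17 = bf n + 11 + 6 by lia.
  apply: wp_weaken (wp_foreach _ _ _ Inv_n) (leqnn _) _.
  + by upds.
  + move=> m s2 s3 [s2d s2D fr2] eqs; split.
    * by rewrite eqs // neq_ltn ltnSn.
    * by rewrite eqs // neq_ltn ltnS leqnSn.
    * by move=> x ltxd; rewrite eqs ?fr2 //; apply/eqP; lia.
  + move=> m s2 ltm [s2d s2D fr2] s2i.
    apply: (@wp_seq _ _ 4 (bf n + 6)); first by lia.
    apply: wp_assign => //=.
    apply: (@wp_seq _ _ (bf n) 5); first by lia.
    apply: (@wp_call n d.+3 (TPair TIdx A) _ _ (Ordinal ltm, a) _ _ _
      (Hf n d.+3)) => //.
    * by rewrite updE /= fr2.
    * by rewrite updE eqxx s2i s2D.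
    * move=> s3 s3d fr3; apply: wp_assign => //=; (split; first split).
      - rewrite updE eqxx s3d fr3 // updE ltn_eqF // s2d /acc.
        by rewrite (enum_ord_drop ltm).
      - by rewrite updE ltn_eqF // fr3 ?updE ?ltn_eqF //; lia.
      - by move=> x ltxd; upds; rewrite fr3 ?updE ?ltn_eqF ?fr2 //; lia.
      - by upds; rewrite fr3 ?updE ?ltn_eqF //; lia.
  + move=> s2 [s2d s2D fr2]; apply: wp_assign => //=; split.
      by rewrite updE eqxx s2d /acc drop0.
    by move=> x ltxd; rewrite updE ltn_eqF // fr2.
- move=> B; exists (fun n => n * 9 + 30).
    apply: poly_boundedD (poly_bounded_cst _).
    exact: poly_boundedM poly_bounded_id (poly_bounded_cst _).
  move=> n d s [f i] s0 d0 sd; have := ltn_ord i; rewrite ltnS => le_in.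
  apply: (@wp_seq _ _ (i * 9 + 20) 3); first by lia.
  apply: wp_weaken (wp_drop sd) (leqnn _) _ => s1 [s1d fr].
  apply: wp_assign => //=; split.
    rewrite updE eqxx s1d -map_drop (enum_ord_drop (ltn_ord i)) /=.
    by congr (vof (f _)); apply: val_inj.
  by move=> x ltxd; rewrite updE ltn_eqF // fr.
- exists (fun n => n * 9 + 30).
    apply: poly_boundedD (poly_bounded_cst _).
    exact: poly_boundedM poly_bounded_id (poly_bounded_cst _).
  move=> n d s [i j] s0 d0 sd; have := ltn_ord j; rewrite ltnS => le_jn.
  apply: (@wp_seq _ _ (j * 9 + 20) 7); first by lia.
  apply: wp_weaken (wp_drop sd) (leqnn _) _ => s1 [s1d fr].
  apply: (@wp_if _ _ _ 4 4) => //.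
  rewrite s1d drop_nseq -/(enc_nat F (i - j)) vtrue_enc_nat subn_gt0.
  case: ltnP => ij; apply: wp_assign => //=.
    split; first by rewrite updE eqxx leqNgt ij.
    by move=> x ltxd; rewrite updE ltn_eqF // fr.
  split; first by rewrite updE eqxx ij.
  by move=> x ltxd; rewrite updE ltn_eqF // fr.
Qed.

End CompileCorrect.

(** * From unit cost to bit cost *)

Fixpoint all_nums (F : Type) (P : F -> Prop) (v : value F) : Prop :=
  match v with
  | Defs.Nil => True
  | Defs.Num x => P x
  | Defs.Cons a b => all_nums P a /\ all_nums P b
  end.

Section Transfer.
Variables (F : numDomainType) (w : F -> nat) (P : nat -> F -> Prop).
Hypothesis P_mono : forall k l x, k <= l -> P k x -> P l x.
Hypothesis P0 : forall k, P k 0%R.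
Hypothesis PD : forall k x y, P k x -> P k y -> P k.+1 (x + y)%R.
Hypothesis PB : forall k x y, P k x -> P k y -> P k.+1 (x - y)%R.

Local Notation w0 := (@unit_length F).

Lemma all_nums_mono k l v : k <= l -> all_nums (P k) v -> all_nums (P l) v.
Proof.
move=> le_kl; elim: v => //= [x|a IHa b IHb [Pa Pb]]; first exact: P_mono.
by split; auto.
Qed.

Lemma vlen_unit v : vlen w0 v = 0.
Proof. by case: v. Qed.

Lemma eval_all_nums k s e :
  (forall x, all_nums (P k) (s x)) ->
  all_nums (P (k + ecost w0 s e)) (eval s e).
Proof.
move=> Ps; elim: e => //=.
- by move=> x; apply: all_nums_mono (Ps x); lia.
- by move=> e1 P1 e2 P2; split; [move: P1|move: P2]; apply: all_nums_mono; lia.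
- by move=> e; case: (eval s e) => //= a b [Pa _]; apply: all_nums_mono Pa; lia.
- by move=> e; case: (eval s e) => //= a b [_ Pb]; apply: all_nums_mono Pb; lia.
- move=> e1 P1 e2 P2; rewrite !vlen_unit; move: P1 P2.
  case: (eval s e1) => // x; case: (eval s e2) => // y /= Px Py.
  rewrite !addn0 addnS; apply: PD; [apply: P_mono Px|apply: P_mono Py]; lia.
- move=> e1 P1 e2 P2; rewrite !vlen_unit; move: P1 P2.
  case: (eval s e1) => // x; case: (eval s e2) => // y /= Px Py.
  rewrite !addn0 addnS; apply: PB; [apply: P_mono Px|apply: P_mono Py]; lia.
- move=> e1 _ e2 _; case: (eval s e1) => // x; case: (eval s e2) => // y /=.
  by rewrite /arith /vbool /=; case: (x <= y)%R.
Qed.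

Variables (L W : nat).
Hypothesis wP : forall x, P L x -> w x <= W.

Lemma vlen_le v : all_nums (P L) v -> vlen w v <= W.
Proof. by case: v => //= x /wP. Qed.

(** In the factor [2 * W + 1], an operation pays for its own unit and for the lengths of its two
    operands. *)
Lemma ecost_transfer k s e :
  (forall x, all_nums (P k) (s x)) -> k + ecost w0 s e <= L ->
  ecost w s e <= ecost w0 s e * (2 * W + 1).
Proof.
move=> Ps; have arith_case e1 e2 :
    (k + ecost w0 s e1 <= L -> ecost w s e1 <= ecost w0 s e1 * (2 * W + 1)) ->
    (k + ecost w0 s e2 <= L -> ecost w s e2 <= ecost w0 s e2 * (2 * W + 1)) ->
    k + (ecost w0 s e1 + ecost w0 s e2 + vlen w0 (eval s e1)
         + vlen w0 (eval s e2)).+1 <= L ->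
    (ecost w s e1 + ecost w s e2 + vlen w (eval s e1) + vlen w (eval s e2)).+1
    <= (ecost w0 s e1 + ecost w0 s e2 + vlen w0 (eval s e1)
         + vlen w0 (eval s e2)).+1 * (2 * W + 1).
  rewrite !vlen_unit !addn0 => H1 H2 leL.
  have l1 : vlen w (eval s e1) <= W.
    by apply/vlen_le/all_nums_mono/(eval_all_nums e1 Ps); lia.
  have l2 : vlen w (eval s e2) <= W.
    by apply/vlen_le/all_nums_mono/(eval_all_nums e2 Ps); lia.
  have {}H1 := H1 ltac:(lia); have {}H2 := H2 ltac:(lia).
  by rewrite mulSn mulnDl; lia.
elim: e => //=; try by move=> *; lia.
- by move=> e1 IH1 e2 IH2; apply: arith_case.
- by move=> e1 IH1 e2 IH2; apply: arith_case.
- by move=> e1 IH1 e2 IH2; apply: arith_case.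
Qed.

(** Control flow does not depend on [w], so the same run is available at both costs. Each arithmetic
    operation raises the level of numbers by one, hence after t steps from level k all numbers are
    at level k + t at most, where their length is bounded by [W]. *)
Lemma exec_transfer c s t s' k :
  exec w0 c s t s' -> (forall x, all_nums (P k) (s x)) -> k + t <= L ->
  (forall x, all_nums (P (k + t)) (s' x)) /\
  exists2 t', exec w c s t' s' & t' <= t * (2 * W + 1).
Proof.
move=> ex; elim: ex k => {c s t s'}.
- move=> s k Ps leL; split; last by exists 1; [constructor|lia].
  by move=> x; apply: all_nums_mono (Ps x); lia.
- move=> s x e k Ps leL; split=> [y|].
    rewrite /upd; case: eqP => _.
      by apply: all_nums_mono (eval_all_nums e Ps); lia.
    by apply: all_nums_mono (Ps y); lia.
  exists (ecost w s e).+1; first by constructor.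
  by rewrite mulSn; have := @ecost_transfer _ _ e Ps ltac:(lia); lia.
- move=> c1 c2 s s1 s2 t1 t2 _ IH1 _ IH2 k Ps leL.
  have [P1 [t1' ex1 le1]] := IH1 k Ps ltac:(lia).
  have [P2 [t2' ex2 le2]] := IH2 (k + t1) P1 ltac:(lia).
  split; first by move=> x; apply: all_nums_mono (P2 x); lia.
  exists (t1' + t2').+1; first exact: exec_seq ex1 ex2.
  by rewrite mulSn mulnDl; lia.
- move=> e c1 c2 s s1 t tr _ IH k Ps leL.
  have [P1 [t' ex le]] := IH k Ps ltac:(lia).
  split; first by move=> x; apply: all_nums_mono (P1 x); lia.
  exists (ecost w s e + t').+1; first exact: exec_if_true.
  by rewrite mulSn mulnDl; have := @ecost_transfer _ _ e Ps ltac:(lia); lia.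
- move=> e c1 c2 s s1 t tr _ IH k Ps leL.
  have [P1 [t' ex le]] := IH k Ps ltac:(lia).
  split; first by move=> x; apply: all_nums_mono (P1 x); lia.
  exists (ecost w s e + t').+1; first exact: exec_if_false.
  by rewrite mulSn mulnDl; have := @ecost_transfer _ _ e Ps ltac:(lia); lia.
- move=> e c s s1 s2 t1 t2 tr _ IH1 _ IH2 k Ps leL.
  have [P1 [t1' ex1 le1]] := IH1 k Ps ltac:(lia).
  have [P2 [t2' ex2 le2]] := IH2 (k + t1) P1 ltac:(lia).
  split; first by move=> x; apply: all_nums_mono (P2 x); lia.
  exists (ecost w s e + t1' + t2').+1; first exact: exec_while_true ex1 ex2.
  by rewrite mulSn !mulnDl; have := @ecost_transfer _ _ e Ps ltac:(lia); lia.
- move=> e c s tr k Ps leL.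
  split; first by move=> x; apply: all_nums_mono (Ps x); lia.
  exists (ecost w s e).+1; first exact: exec_while_false.
  by rewrite mulSn; have := @ecost_transfer _ _ e Ps ltac:(lia); lia.
Qed.

End Transfer.

(** * Rationals over a common denominator *)

Definition frac_le (D k : nat) (q : rat) : Prop :=
  exists2 a : int, q = (a%:~R / D%:R)%R & `|a| <= 2 ^ k.

Lemma frac_le_mono D k l q : k <= l -> frac_le D k q -> frac_le D l q.
Proof.
move=> le_kl [a -> lea]; exists a => //.
by apply: leq_trans lea _; rewrite leq_exp2l.
Qed.

Lemma frac_le0 D k : frac_le D k 0%R.
Proof. by exists 0%R => //; rewrite mul0r. Qed.

Lemma frac_leD D k x y :
  frac_le D k x -> frac_le D k y -> frac_le D k.+1 (x + y)%R.
Proof.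
move=> [a -> lea] [b -> leb]; exists (a + b)%R; first by rewrite intrD mulrDl.
by rewrite expnS; lia.
Qed.

Lemma frac_leB D k x y :
  frac_le D k x -> frac_le D k y -> frac_le D k.+1 (x - y)%R.
Proof.
move=> [a -> lea] [b -> leb]; exists (a - b)%R; first by rewrite intrB mulrBl.
by rewrite expnS; lia.
Qed.

Lemma nat_bits_le m k : m <= 2 ^ k -> nat_bits m <= k.+1.
Proof.
rewrite /nat_bits ltnS => lem.
by rewrite -(trunc_expnK k (isT : 1 < 2)) leq_trunc_log.
Qed.

Lemma nat_bits_gt m : m < 2 ^ nat_bits m.
Proof. exact: trunc_log_ltn. Qed.

(** The reduced denominator divides [D], since it divides [numq q] times [D] and is coprime to
    [numq q]. Hence reduction enlarges neither part. The constant 3 is one bit for each of the two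
    bounds and one for the sign. *)
Lemma rat_bits_frac D k l q :
  0 < D -> D <= 2 ^ l -> frac_le D k q -> rat_bits q <= k + l + 3.
Proof.
move=> D0 leD [a q_eq lea].
have D0' : (D%:R : rat) != 0%R by rewrite pnatr_eq0 -lt0n.
have eqz : (a * denq q = numq q * D%:Z)%R.
  apply: (@intr_inj rat); rewrite !intrM numqE {2}q_eq.
  by rewrite -pmulrn mulrAC divfK.
have dvd : `|denq q| %| D.
  have : `|denq q| %| `|numq q| * D.
    apply/dvdnP; exists `|a|; have := congr1 absz eqz.
    by rewrite !abszM /= => ->.
  by rewrite Gauss_dvdr // coprime_sym coprime_num_den.
have den0 : 0 < `|denq q| by rewrite absz_gt0 denq_eq0.
have led : `|denq q| <= 2 ^ l by apply: leq_trans leD; apply: dvdn_leq.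
have len : `|numq q| <= 2 ^ k.
  apply: leq_trans lea; have := congr1 absz eqz; rewrite !abszM /= => eqn.
  rewrite -(leq_pmul2r D0) -eqn leq_mul2l dvdn_leq ?orbT //.
rewrite /rat_bits; have := nat_bits_le led; have := nat_bits_le len; lia.
Qed.

(** * The assignment problem *)

Section Assignment.
Variables (F : realDomainType) (n : nat).
Local Notation J := 'I_n.+1.
Implicit Types (i j x : J) (phi : J -> J) (M : J -> J -> F).

Local Open Scope ring_scope.

(** Comparison is the only test on indices that terms offer. The definitions below keep to such
    primitives so that [t_solveE] holds by computation. *)
Definition eqJ i j : bool := (i <= j)%N && (j <= i)%N.

Lemma eqJE i j : eqJ i j = (i == j).
Proof. by rewrite /eqJ -eqn_leq. Qed.

(** The result is [ord0] if nothing satisfies [P], which is why [hstep] tests it again. *)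
Definition find1 (P : J -> bool) : J :=
  foldr (fun i acc => if P i then i else acc) ord0 (enum J).

Lemma find1P (P : J -> bool) i : P i -> P (find1 P).
Proof.
rewrite /find1; move: (mem_enum J i); rewrite inE.
elim: (enum J) => //= k l IHl; rewrite inE; case: ifP => // Pk.
by case: eqP => [-> _ Pi|_]; [rewrite Pi in Pk|apply: IHl].
Qed.

Definition argm (P : J -> J -> bool) M : J * J :=
  foldr (fun i acc => foldr (fun j acc =>
      if P i j && (~~ P acc.1 acc.2 || (M i j <= M acc.1 acc.2)) then (i, j)
      else acc) acc (enum J)) (ord0, ord0) (enum J).

(** For one fixed entry, being at least as good as it is established when the loops reach this entry
    and preserved by every other update. *)
Lemma argmP (P : J -> J -> bool) M i j : P i j ->
  P (argm P M).1 (argm P M).2 /\ M (argm P M).1 (argm P M).2 <= M i j.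
Proof.
pose better (acc : J * J) i j :=
  P i j -> P acc.1 acc.2 /\ M acc.1 acc.2 <= M i j.
suff: better (argm P M) i j by apply.
rewrite /argm; set row := fun i (_ : J * J) => foldr _ _ _.
have row_acc acc k i' j' : better acc i' j' -> better (row k acc) i' j'.
  rewrite /row; elim: (enum J) => //= j1 l IHl /IHl; set a := foldr _ _ _.
  case: ifP => // /andP[Pk le_k] bet Pij'; split=> //=.
  have [Pa le_a] := bet Pij'; rewrite Pa /= in le_k; exact: le_trans le_a.
have row_k acc k j' : better (row k acc) k j'.
  rewrite /row; have := mem_enum J j'; rewrite inE.
  elim: (enum J) => //= j1 l IHl; rewrite inE; set a := foldr _ _ _.
  case: ifP => [/andP[Pk le_k]|nb].
    case: eqP => [->|_ /= /IHl bet]; first by move=> _ _; split.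
    move=> Pj; split=> //=; have [Pa le_a] := bet Pj.
    by rewrite Pa /= in le_k; apply: le_trans le_a.
  case: eqP => [-> _ Pj|_ /= /IHl //]; rewrite Pj /= in nb.
  move/negbT: nb; rewrite negb_or negbK -ltNge => /andP[Pa /ltW lea].
  by split.
have := mem_enum J i; rewrite inE.
elim: (enum J) => //= k l IHl; rewrite inE.
by case: eqP => [-> _|_ /IHl]; [apply: row_k|apply: row_acc].
Qed.

Definition iterJ T (f : T -> T) (a : T) : T := foldr (fun=> f) a (enum J).

Lemma iterJE T (f : T -> T) (a : T) : iterJ f a = iter n.+1 f a.
Proof.
by rewrite /iterJ -[in RHS](size_enum_ord n.+1); elim: (enum J) => //= _ l ->.
Qed.

(** * The Hungarian method on reduced costs *)

Section Hungarian.
Variables (cols : J -> bool).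

(* A state consists of the reduced costs, the rows [S] and columns [T]        *)
(* reached so far, for each [s] in [S] a tight matching that leaves exactly   *)
(* [s] unmatched, a flag telling that the search is over, and its result.     *)
Definition hstate : Type :=
  (J -> J -> F) * ((J -> bool) * ((J -> bool) * ((J -> J -> J) *
    (bool * (J -> J))))).

(** The cheapest entry [ij] from a reached row to an unreached column becomes tight by a shift of
    the duals. Giving its column to [ij.1] in the alternative for that row yields [psi]. If the
    column belongs to a row [o] of [phi], then [o] and the column become reached, and [psi] is the
    alternative leaving [o] out; otherwise [psi] is the augmented matching. Storing whole matchings
    avoids tracing back augmenting paths. *)
Definition hstep (R : J -> bool) phi (st : hstate) : hstate :=
  let M := st.1 in let S := st.2.1 in let T := st.2.2.1 in
  let m := st.2.2.2.1 in
  if st.2.2.2.2.1 then st else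
  let ij := argm (fun i j => S i && (cols j && ~~ T j)) M in
  let M' := fun i j =>
    if S i then if T j then M i j else M i j - M ij.1 ij.2
    else if T j then M i j + M ij.1 ij.2 else M i j in
  let psi := fun i => if eqJ i ij.1 then ij.2 else m ij.1 i in
  let o := find1 (fun i => R i && eqJ (phi i) ij.2) in
  if R o && eqJ (phi o) ij.2 then
    (M', ((fun i => eqJ i o || S i), ((fun j => eqJ j ij.2 || T j),
         ((fun s => if eqJ s o then psi else m s), (false, phi)))))
  else (M', (S, (T, (m, (true, psi))))).

Definition insert_row (x : J) (st : (J -> J -> F) * ((J -> bool) * (J -> J))) :
    (J -> J -> F) * ((J -> bool) * (J -> J)) :=
  let r := iterJ (hstep st.2.1 st.2.2)
    (st.1, ((fun i => eqJ i x), ((fun=> false), ((fun=> st.2.2),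
           (false, st.2.2))))) in
  (r.1, ((fun i => eqJ i x || st.2.1 i), r.2.2.2.2.2)).

Definition assignment (rows : J -> bool) (c : J -> J -> F) : J -> J :=
  (foldr (fun x st => if rows x then insert_row x st else st)
     (c, ((fun=> false), (fun=> ord0))) (enum J)).2.2.

Variable c : J -> J -> F.

(* The algorithm never computes the dual variables u and v, it only keeps the *)
(* reduced costs [M].                                                         *)
Definition dual_feasible (R : J -> bool) phi M : Prop :=
  exists u v : J -> F,
    [/\ forall i j, cols j -> M i j = c i j - u i - v j,
        forall i j, cols j -> 0 <= M i j,
        forall j, cols j -> v j <= 0 &
        forall j, cols j -> (forall i, R i -> phi i <> j) -> v j = 0].

Definition tight_matching (R : J -> bool) phi M : Prop :=
  [/\ forall i, R i -> M i (phi i) = 0,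
      forall i, R i -> cols (phi i) &
      forall i i', R i -> R i' -> phi i = phi i' -> i = i'].

Section Insert.
Variables (R : J -> bool) (phi : J -> J) (x : J).
Hypothesis xR : ~~ R x.
Hypothesis free_col : exists2 j, cols j & forall i, R i -> phi i <> j.
Hypothesis phi_cols : forall i, R i -> cols (phi i).
Hypothesis phi_inj : forall i i', R i -> R i' -> phi i = phi i' -> i = i'.

Let R' i := (i == x) || R i.

(** [f] matches all rows but [s] onto exactly the columns used by [phi]. The last clause says that
    it departs from [phi] only inside [S], and that its entries lie in S x T or outside both, where
    a shift of the duals leaves the reduced costs unchanged. *)
Definition alternative M (S T : J -> bool) (s : J) (f : J -> J) : Prop :=
  let Rs := fun i => R' i && (i != s) in
  [/\ forall i, Rs i -> M i (f i) = 0,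
      forall i, Rs i -> exists2 i', R i' & phi i' = f i,
      forall i', R i' -> exists2 i, Rs i & f i = phi i',
      forall i i', Rs i -> Rs i' -> f i = f i' -> i = i' &
      forall i, Rs i -> S i = T (f i) /\ (~~ S i -> f i = phi i)].

Definition exploring (st : hstate) : Prop :=
  let M := st.1 in let S := st.2.1 in let T := st.2.2.1 in
  let m := st.2.2.2.1 in
  [/\ S x, forall i, S i -> R' i,
      forall i, R i -> S i = T (phi i),
      forall j, T j -> exists2 i, R i & phi i = j &
      (forall i, R i -> M i (phi i) = 0) /\
      forall s, S s -> alternative M S T s (m s)].

(** An unfinished search has reached one more row than it has made steps. As there are n + 1 rows,
    it must be over after n + 1 steps. *)
Definition hinv (k : nat) (st : hstate) : Prop :=
  if st.2.2.2.2.1 then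
    dual_feasible R' st.2.2.2.2.2 st.1 /\ tight_matching R' st.2.2.2.2.2 st.1
  else [/\ dual_feasible R phi st.1, exploring st
         & #|[set i | st.2.1 i]| = k.+1].

Lemma hstep_inv k st : hinv k st -> hinv k.+1 (hstep R phi st).
Proof.
rewrite /hinv /hstep.
case: st => M [S [T [m [done res]]]] /=; case: done => //=.
move=> [[u [v [M_eq M_ge0 v_le0 v0]]] [Sx SR ST TR [phi0 alt]] cardS].
set ij := argm _ _; rewrite /= in Sx SR ST TR phi0 alt.
(* The minimum is over a nonempty set: the free column is not in [T], whose columns are all
   matched. *)
have [[Si /andP[cj nTj]] ij_min] : (S ij.1 /\ cols ij.2 && ~~ T ij.2) /\
    forall i j, S i -> cols j -> ~~ T j -> M ij.1 ij.2 <= M i j.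
  have [j0 cj0 free] := free_col.
  have Pxj : S x && (cols j0 && ~~ T j0).
    rewrite Sx cj0 /=; apply/negP => /TR[i Ri]; exact: free.
  have [/andP[-> ->] _] :=
    @argmP (fun i j => S i && (cols j && ~~ T j)) M _ _ Pxj.
  split=> // i j Si cj nTj.
  by have [] := @argmP (fun i j => S i && (cols j && ~~ T j)) M i j;
    rewrite ?Si ?cj.
set delta := M ij.1 ij.2.
pose M' i j := if S i then if T j then M i j else M i j - delta
  else if T j then M i j + delta else M i j.
rewrite -/M'.
have delta_ge0 : 0 <= delta by apply: M_ge0.
(* The shifted duals: [v] only decreases, since [delta] is nonnegative, and it does not move on free
   columns, which are outside [T]. *)
pose u' i := if S i then u i + delta else u i.
pose v' j := if T j then v j - delta else v j.
have M'_eq i j : cols j -> M' i j = c i j - u' i - v' j.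
  move=> cj'; rewrite /M' /u' /v' M_eq //.
  by case: ifP => _; case: ifP => _; ring.
have M'_ge0 i j : cols j -> 0 <= M' i j.
  move=> cj'; rewrite /M'; have := M_ge0 i j cj'.
  case: ifP => Si'; case: ifP => Tj' //; last by move=> ?; rewrite addr_ge0.
  by move=> _; rewrite subr_ge0 ij_min ?Tj'.
have v'_le0 j : cols j -> v' j <= 0.
  move=> cj'; rewrite /v'; have := v_le0 j cj'; case: ifP => // _ vj.
  by rewrite subr_le0 (le_trans vj).
have v'0 j : cols j -> (forall i, R i -> phi i <> j) -> v' j = 0.
  move=> cj' free; rewrite /v'; case: ifP => [/TR[i Ri /free]|_] //.
  exact: v0.
have M'0 i j : M i j = 0 -> S i = T j -> M' i j = 0.
  by rewrite /M' => -> ->; case: (T j).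
have M'ij : M' ij.1 ij.2 = 0 by rewrite /M' Si (negPf nTj) subrr.
have phi'0 i : R i -> M' i (phi i) = 0 by move=> Ri; apply: M'0; auto.
set psi := fun i => if eqJ i ij.1 then _ else _.
have psiE i : psi i = if i == ij.1 then ij.2 else m ij.1 i.
  by rewrite /psi eqJE.
have [alt0 alt_im alt_sur alt_inj alt_S] := alt _ Si.
set o := find1 _.
have [/andP[Ro]|no] := boolP (R o && eqJ (phi o) ij.2).
- rewrite eqJE => /eqP phio.
  have nSo : ~~ S o by rewrite ST ?phio.
  have o_ij : o != ij.1 by apply: contraNneq nSo => ->.
  have xo : x != o by apply: contraNneq nSo => <-.
  (* The row [o] is not yet reached, so the alternative for [ij.1] agrees with [phi] there. Leaving
     [o] out therefore frees the column [ij.2]. *)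
  have mo : m ij.1 o = ij.2.
    by rewrite (alt_S o _).2 ?phio ?nSo // /R' Ro orbT.
  rewrite /=; split; first by exists u', v'.
  + have S'T' i : R i -> eqJ i o || S i = eqJ (phi i) ij.2 || T (phi i).
      move=> Ri; rewrite !eqJE -phio ST //; congr orb.
      by apply/eqP/eqP => [->|/phi_inj->].
    split=> //=.
    * by rewrite Sx orbT.
    * by move=> i /orP[|/SR //]; rewrite eqJE => /eqP->; rewrite /R' Ro orbT.
    * by move=> j /orP[|/TR //]; rewrite eqJE => /eqP->; exists o.
    split=> // s; rewrite eqJE; case: eqP => [-> _|/eqP s_o /= Ss].
      have Rs_m i : R' i && (i != o) -> i != ij.1 -> R' i && (i != ij.1).
        by case/andP=> -> _ ->.
      have Ro' : R' o && (o != ij.1) by rewrite /R' Ro orbT.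
      split.
      - move=> i Hi; rewrite psiE; case: eqP => [-> //|/eqP i_ij].
        have Hi' := Rs_m _ Hi i_ij.
        by apply: M'0; [apply: alt0|apply: (alt_S _ Hi').1].
      - move=> i Hi; rewrite psiE; case: eqP => [_|/eqP i_ij].
          by exists o.
        by apply: alt_im; apply: Rs_m.
      - move=> i' Ri'; have [i Hi mi] := alt_sur _ Ri'.
        have [io|i_o] := eqVneq i o.
          exists ij.1; last by rewrite psiE eqxx -mi io mo.
          by rewrite SR //= eq_sym.
        exists i; first by case/andP: Hi => ->.
        by rewrite psiE; case/andP: Hi => _ /negPf->.
      - move=> i i' Hi Hi'; rewrite !psiE.
        case: eqP => [->|/eqP i_ij]; case: eqP => [->|/eqP i'_ij] //.
        + rewrite -mo => /alt_inj -/(_ Ro' (Rs_m _ Hi' i'_ij)) oi'.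
          by move: Hi'; rewrite -oi' eqxx andbF.
        + rewrite -mo => /alt_inj -/(_ (Rs_m _ Hi i_ij) Ro') oi'.
          by move: Hi; rewrite oi' eqxx andbF.
        + by apply: alt_inj; apply: Rs_m.
      - move=> i Hi; rewrite psiE !eqJE.
        have /andP[_ /negPf->] := Hi; rewrite /=.
        have [->|i_ij] := eqVneq i ij.1; first by rewrite Si eqxx.
        have Hi' := Rs_m _ Hi i_ij; have [-> ?] := alt_S _ Hi'; split=> //.
        case: eqP => // mi.
        have oi := alt_inj _ _ Hi' Ro' (etrans mi (esym mo)).
        by move: Hi; rewrite oi eqxx andbF.
    have [a0 a_im a_sur a_inj a_S] := alt _ Ss.
    split=> // [i Hi|i Hi].
      by apply: M'0; [apply: a0|apply: (a_S _ Hi).1].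
    rewrite !eqJE; have [-> a_phi] := a_S _ Hi.
    have Ho : R' o && (o != s) by rewrite /R' Ro orbT eq_sym.
    have mso : m s o = ij.2 by rewrite (a_S _ Ho).2.
    have -> : (m s i == ij.2) = (i == o).
      by rewrite -mso; apply/eqP/eqP => [/a_inj->|->].
    by split=> //; rewrite negb_or => /andP[_ /a_phi].
  + have := cardsU1 o [set i | S i]; rewrite inE nSo cardS add1n => <-.
    by apply: eq_card => i; rewrite !inE eqJE.
(* Here [ij.2] is free, so [psi] covers the columns of [phi] and one more. *)
- have {}no i : R i -> phi i <> ij.2.
    move=> Ri phii; case/negP: no.
    have := @find1P (fun i => R i && eqJ (phi i) ij.2) i.
    by apply; rewrite Ri eqJE; apply/eqP.
  rewrite /=; split.
    exists u', v'; split=> // j cj' free; apply: v'0 => // i Ri phii.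
    have [i1 Hi1 mi1] := alt_sur _ Ri; have /andP[R'i1 /negPf i1_ij] := Hi1.
    by apply: (free i1) => //; rewrite psiE i1_ij mi1.
  split=> [i R'i|i R'i|i i' R'i R'i'].
  + rewrite psiE; case: eqP => [-> //|/eqP i_ij].
    have Hi : R' i && (i != ij.1) by rewrite R'i.
    by apply: M'0; [apply: alt0|apply: (alt_S _ Hi).1].
  + rewrite psiE; case: eqP => [//|/eqP i_ij].
    have Hi : R' i && (i != ij.1) by rewrite R'i.
    by have [i' Ri' <-] := alt_im _ Hi; apply: phi_cols.
  + have neq i0 : R' i0 -> i0 != ij.1 -> m ij.1 i0 <> ij.2.
      move=> R0 i0_ij mi0.
      have [|i1 Ri1 phii1] := alt_im i0; first by rewrite R0.
      by apply: (no _ Ri1); rewrite phii1.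
    rewrite !psiE.
    case: eqP => [->|/eqP i_ij]; case: eqP => [->|/eqP i'_ij] //.
    * by move/esym/neq; case.
    * by move/neq; case.
    * by apply: alt_inj; rewrite ?R'i ?R'i'.
Qed.

Lemma insert_rowP M : dual_feasible R phi M -> tight_matching R phi M ->
  let st := insert_row x (M, (R, phi)) in
  dual_feasible st.2.1 st.2.2 st.1 /\ tight_matching st.2.1 st.2.2 st.1.
Proof.
move=> dual [phi0 _ _]; rewrite /insert_row /= iterJE.
set st0 := (M, _); have : hinv 0 st0.
  split=> //; last first.
    by rewrite -(cards1 x); apply: eq_card => i; rewrite !inE /= eqJE.
  have R'P i : R' i && (i != x) -> R i.
    by rewrite /R'; case: eqP => //=; rewrite andbT.
  have R'I i : R i -> R' i && (i != x).
    by move=> Ri; rewrite /R' Ri orbT; apply: contraNneq xR => <-.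
  split=> //=; first by rewrite eqJE.
  - by move=> i; rewrite eqJE /R' => ->.
  - by move=> i Ri; rewrite eqJE; apply/negbTE; apply: contraNneq xR => <-.
  split=> // s; rewrite eqJE => /eqP->; split.
  - by move=> i /R'P; apply: phi0.
  - by move=> i /R'P Ri; exists i.
  - by move=> i /R'I Ri; exists i.
  - by move=> i i' /R'P ? /R'P ?; apply: phi_inj.
  - by move=> i /andP[_ /negPf ix]; rewrite eqJE.
move=> H0; have {H0} : hinv n.+1 (iter n.+1 (hstep R phi) st0).
  by elim: (n.+1) => // k; rewrite iterS; apply: hstep_inv.
rewrite /hinv; case: ifP => [_|_ [_ _ card_S]].
  have R'E i : (eqJ i x || R i) = R' i by rewrite eqJE.
  move=> [[u [v [Meq Mge vle v0]]] [t0 tc tinj]]; split.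
    exists u, v; split=> // j cj free; apply: v0 => // i; rewrite -R'E.
    exact: free.
  by split=> [i|i|i i']; rewrite !R'E; auto.
by have := max_card (mem [set i | (iter n.+1 (hstep R phi) st0).2.1 i]);
  rewrite card_S card_ord ltnn.
Qed.

End Insert.

(** Weak duality. The cost of [phi] is the sum of [u] over the rows plus that of [v] over all
    columns, as matched entries are tight and [v] vanishes on free columns. Any other assignment
    [psi] costs at least the sum of [u] plus that of [v] over its own columns, which is no smaller
    because [v <= 0]. The zero duals are feasible at the start because the costs are nonnegative. *)
Lemma assignmentP (rows : J -> bool) :
  (#|[set i | rows i]| <= #|[set j | cols j]|)%N ->
  (forall i j, 0 <= c i j) ->
  let phi := assignment rows c in
  [/\ forall i, rows i -> cols (phi i),
      forall i i', rows i -> rows i' -> phi i = phi i' -> i = i' &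
      forall psi : J -> J, (forall i, rows i -> cols (psi i)) ->
        (forall i i', rows i -> rows i' -> psi i = psi i' -> i = i') ->
        \sum_(i | rows i) c i (phi i) <= \sum_(i | rows i) c i (psi i)].
Proof.
move=> le_card c_ge0; rewrite /assignment.
set st := foldr _ _ _.
have : [/\ forall i, st.2.1 i = rows i, dual_feasible st.2.1 st.2.2 st.1 &
           tight_matching st.2.1 st.2.2 st.1].
  suff: [/\ forall i, st.2.1 i = rows i && (i \in enum J),
      dual_feasible st.2.1 st.2.2 st.1 & tight_matching st.2.1 st.2.2 st.1].
    by case=> H ? ?; split=> // i; rewrite H mem_enum andbT.
  rewrite /st {st}; have := enum_uniq J.
  elim: (enum J) => [_|x l IHl /andP[xl /IHl]] /=.
    split=> //; first by move=> i; rewrite andbF.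
    exists (fun=> 0), (fun=> 0); split=> // i j _.
    by rewrite !subr0.
  set st := foldr _ _ _; case: ifPn => [rx|nrx] [HR dual tight]; last first.
    split=> // i; rewrite HR inE; case: eqP => [->|] //.
    by rewrite (negPf nrx).
  case: st HR dual tight => M [R phi] /= HR dual tight.
  have [t0 tc tinj] := tight.
  have xR : ~~ R x by rewrite HR rx.
  (* By counting: the rows inserted so far omit [x], hence are fewer than the columns. *)
  have free_col : exists2 j, cols j & forall i, R i -> phi i <> j.
    have [/existsP[j /andP[cj /forallP free]]|] := boolP
        [exists j, cols j && [forall i, R i ==> (phi i != j)]].
      by exists j => // i Ri; apply/eqP; have := free i; rewrite Ri.
    move/existsPn=> nofree; suff: (#|[set j | cols j]| < #|[set i | rows i]|)%N.
      by rewrite ltnNge le_card.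
    have sub : [set j | cols j] \subset phi @: [set i | R i].
      apply/subsetP => j; rewrite inE => cj; have := nofree j.
      rewrite cj /= negb_forall => /existsP[i]; rewrite negb_imply negbK.
      by case/andP=> Ri /eqP <-; apply: imset_f; rewrite inE.
    apply: leq_ltn_trans (subset_leq_card sub) _.
    apply: leq_ltn_trans (leq_imset_card _ _) _.
    apply: proper_card; apply/properP; split.
      by apply/subsetP => i; rewrite !inE HR => /andP[].
    by exists x; rewrite inE // (negPf xR).
  have [dual' tight'] := insert_rowP xR free_col tc tinj dual tight.
  split=> // i; rewrite /= eqJE HR inE.
  by case: eqP => [->|] //=; rewrite rx.
case: st => M [R phi] /= [HR [u [v [Meq Mge vle v0]]] [t0 tc tinj]].
split=> [i|i i'|psi psi_cols psi_inj]; rewrite -?HR; try by auto.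
have cE i j : cols j -> c i j = M i j + u i + v j.
  by move=> cj; rewrite Meq //; ring.
rewrite (eq_bigr (fun i => u i + v (phi i))) => [|i]; last first.
  by rewrite -HR => Ri; rewrite cE ?tc // t0 // add0r.
rewrite [leRHS](eq_bigr (fun i => M i (psi i) + (u i + v (psi i)))); last first.
  by move=> i ri; rewrite cE ?addrA //; apply: psi_cols.
rewrite !big_split /= addrCA lerD2l.
rewrite -[leLHS]add0r; apply: lerD.
  by apply: sumr_ge0 => i ri; apply/Mge/psi_cols.
have -> : \sum_(i | rows i) v (phi i) = \sum_(j in phi @: [set i | rows i]) v j.
  rewrite big_imset; first by apply: eq_bigl => i; rewrite inE.
  by move=> i i'; rewrite !inE -!HR; apply: tinj.
have -> : \sum_(j in phi @: [set i | rows i]) v j = \sum_(j | cols j) v j.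
  rewrite [RHS](bigID (mem (phi @: [set i | rows i]))) /=.
  rewrite [X in _ = _ + X]big1 ?addr0.
    apply: eq_bigl => j; case: imsetP => [[i]|_]; rewrite ?andbF //.
    by rewrite inE -HR => Ri ->; rewrite tc.
  move=> j /andP[cj /imsetP nim]; apply: v0 => // i Ri phii; case: nim.
  by exists i; rewrite ?inE -?HR.
rewrite [leLHS](bigID (mem (psi @: [set i | rows i]))) /=.
rewrite -[leRHS]addr0; apply: lerD; last first.
  by apply: sumr_le0 => j /andP[/vle].
rewrite (eq_bigl (mem (psi @: [set i | rows i]))); last first.
  move=> j /=; case: imsetP => [[i]|_]; rewrite ?andbF //.
  by rewrite inE => ri ->; rewrite psi_cols.
rewrite big_imset /=; first by under eq_bigl do rewrite inE.
by move=> i i'; rewrite !inE; apply: psi_inj.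
Qed.

End Hungarian.
End Assignment.

(** * Dynamic programming on a rooted forest *)

(** If [f g x] depends on [g] only at lower ranks, the value at rank k is stable after k + 1
    iterations; ranks are at most n, so n + 1 iterations reach a fixed point. *)
Lemma iterJ_fix n T (f : ('I_n.+1 -> T) -> 'I_n.+1 -> T) (rk : 'I_n.+1 -> nat)
    (g0 : 'I_n.+1 -> T) :
  (forall x, rk x <= n) ->
  (forall g h x, (forall y, rk y < rk x -> g y = h y) -> f g x = f h x) ->
  f (iterJ n f g0) = iterJ n f g0.
Proof.
move=> rk_le f_ext; rewrite iterJE -iterS; apply: boolp.funext => x.
suff: forall k y, rk y < k -> iter k.+1 f g0 y = iter k f g0 y.
  by apply; rewrite ltnS.
elim=> // k IHk y le_yk; rewrite !(iterS _ f); apply: f_ext => z lt_zy.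
by rewrite -iterS IHk // (leq_trans lt_zy).
Qed.

Section DynamicProgramming.
Variables (F : realDomainType) (n : nat).
Local Notation J := 'I_n.+1.
Local Open Scope ring_scope.

Variables (nd : J -> bool) (par : J -> J) (cols : J -> J -> J -> bool).
Variable cst : J -> J -> J -> F.

Definition child (v x : J) : bool := nd x && eqJ (par x) v.

(** Rows other than children get cost 0, so that the result depends on [B] at the children of [v]
    only; [values_fix] relies on this. *)
Definition choice_of (B : J -> J -> F) (v i : J) : J -> J :=
  assignment (cols v i) (child v)
    (fun x j => if child v x then cst x i j + B x j else 0).

Definition value_step (B : J -> J -> F) (v i : J) : F :=
  let phi := choice_of B v i in
  foldr (fun x acc =>
    if child v x then (cst x i (phi x) + B x (phi x)) + acc else acc)
    0 (enum J).

Definition values : J -> J -> F := iterJ n value_step (fun _ _ => 0).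

Definition colors_step (kappa : J -> J) (x : J) : J :=
  if nd x then choice_of values (par x) (kappa (par x)) x else ord0.

Definition colors : J -> J := iterJ n colors_step (fun=> ord0).

Variable dep : J -> nat.
Hypothesis dep_le : forall x, (dep x <= n)%N.
Hypothesis dep_par : forall x, nd x -> (dep (par x) < dep x)%N.
Hypothesis cst_ge0 : forall x i j, 0 <= cst x i j.
Hypothesis enough_cols : forall v i,
  (#|[set x | child v x]| <= #|[set j | cols v i j]|)%N.

Lemma childE v x : child v x = nd x && (par x == v).
Proof. by rewrite /child eqJE. Qed.

Lemma value_stepE B v i : value_step B v i = \sum_(x | child v x)
  (cst x i (choice_of B v i x) + B x (choice_of B v i x)).
Proof.
rewrite -(big_enum_cond _ _ predT) /value_step /=.
by elim: (enum J) => [|x l IHl]; rewrite ?big_nil // big_cons /= IHl.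
Qed.

Lemma values_ge0 v i : 0 <= values v i.
Proof.
rewrite /values iterJE.
suff: forall k w j, 0 <= iter k value_step (fun _ _ => 0) w j by apply.
elim=> //= k IHk w j; rewrite value_stepE.
by apply: sumr_ge0 => x _; apply: addr_ge0.
Qed.

(** The values settle from the leaves upwards, hence the rank [n - dep x]; the colors settle
    downwards, with rank [dep x]. *)
Lemma values_fix : value_step values = values.
Proof.
apply: (@iterJ_fix _ _ _ (fun x => n - dep x)%N) => [x|B C v eqBC].
  by rewrite leq_subr.
have eqc : forall x, child v x -> B x = C x.
  move=> x; rewrite childE => /andP[ndx /eqP par_x]; apply: eqBC.
  rewrite -par_x.
  by have := dep_par ndx; have := dep_le x; lia.
apply: boolp.funext => i; rewrite !value_stepE.
have -> : choice_of B v i = choice_of C v i.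
  congr assignment; apply: boolp.funext => x; apply: boolp.funext => j.
  by case: ifP => // /eqc->.
by apply: eq_bigr => x /eqc->.
Qed.

Lemma valuesE v i : values v i = \sum_(x | child v x)
  (cst x i (choice_of values v i x) + values x (choice_of values v i x)).
Proof. by rewrite -[in LHS]values_fix value_stepE. Qed.

Lemma colors_fix x :
  colors x = if nd x then choice_of values (par x) (colors (par x)) x else ord0.
Proof.
rewrite -[in LHS](_ : colors_step colors = colors) //.
apply: (@iterJ_fix _ _ _ dep) => // g h y eqgh; rewrite /colors_step.
by case: ifP => // /dep_par /eqgh->.
Qed.

Lemma choiceP v i : let phi := choice_of values v i in
  [/\ forall x, child v x -> cols v i (phi x),
      forall x y, child v x -> child v y -> phi x = phi y -> x = y &
      forall psi : J -> J, (forall x, child v x -> cols v i (psi x)) ->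
        (forall x y, child v x -> child v y -> psi x = psi y -> x = y) ->
        \sum_(x | child v x) (cst x i (phi x) + values x (phi x)) <=
        \sum_(x | child v x) (cst x i (psi x) + values x (psi x))].
Proof.
have [|inc inj min] := assignmentP
    (c := fun x j => if child v x then cst x i j + values x j else 0)
    (enough_cols v i).
  by move=> x j; case: ifP => // _; rewrite addr_ge0 ?values_ge0.
split=> // psi psi_cols psi_inj; have := min psi psi_cols psi_inj.
rewrite (eq_bigr (fun x => cst x i (choice_of values v i x) +
  values x (choice_of values v i x))); last by move=> x ->.
rewrite [leRHS](eq_bigr (fun x => cst x i (psi x) + values x (psi x))) //.
by move=> x ->.
Qed.

Definition feasible (kappa : J -> J) : Prop :=
  (forall x, nd x -> cols (par x) (kappa (par x)) (kappa x)) /\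
  (forall x y, nd x -> nd y -> par x = par y -> kappa x = kappa y -> x = y).

Definition total_cost (kappa : J -> J) : F :=
  \sum_(x | nd x) cst x (kappa (par x)) (kappa x).

Lemma colors_feasible : feasible colors.
Proof.
split=> [x ndx|x y ndx ndy eq_par].
  rewrite [colors x]colors_fix ndx.
  have [inc _ _] := choiceP (par x) (colors (par x)).
  by apply: inc; rewrite childE ndx eqxx.
rewrite [colors x]colors_fix [colors y]colors_fix ndx ndy -eq_par.
have [_ inj _] := choiceP (par x) (colors (par x)).
by apply: inj; rewrite childE ?ndx ?ndy ?eq_par eqxx.
Qed.

Lemma sum_children (g : J -> F) :
  \sum_v \sum_(x | child v x) g x = \sum_(x | nd x) g x.
Proof.
rewrite [RHS](partition_big par xpredT) //=; apply: eq_bigr => v _.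
by apply: eq_bigl => x; rewrite childE.
Qed.

(* Summing the Bellman equation over all nodes v, the values at the children  *)
(* cancel against those on the left-hand side.                                *)
Lemma colors_optimal kappa :
  feasible kappa -> (forall x, ~~ nd x -> kappa x = ord0) ->
  total_cost colors <= total_cost kappa.
Proof.
move=> [inc inj] kappa0.
have telescope (k : J -> J) : \sum_(v | nd v) values v (k v) + total_cost k =
    \sum_v \sum_(x | child v x) (cst x (k v) (k x) + values x (k x)).
  rewrite addrC -big_split -sum_children; apply: eq_bigr => v _.
  by apply: eq_bigr => x; rewrite childE => /andP[_ /eqP->].
have colE : \sum_v values v (colors v) =
    \sum_(v | nd v) values v (colors v) + total_cost colors.
  rewrite telescope; apply: eq_bigr => v _; rewrite valuesE.
  apply: eq_bigr => x; rewrite childE => /andP[ndx /eqP par_x].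
  by rewrite [colors x]colors_fix ndx par_x.
have kapE : \sum_v values v (kappa v) <=
    \sum_(v | nd v) values v (kappa v) + total_cost kappa.
  rewrite telescope; apply: ler_sum => v _; rewrite valuesE.
  have [_ _ min] := choiceP v (kappa v); apply: min => [x|x y].
    by rewrite childE => /andP[ndx /eqP <-]; apply: inc.
  rewrite !childE => /andP[ndx /eqP <-] /andP[ndy /eqP /esym]; exact: inj.
move: colE kapE; rewrite ![\sum_v _](bigID nd) /=.
move=> /addrI <-; rewrite lerD2l; apply: le_trans.
(* What remains are the values at indices that are not nodes, such as the root; both colorings are
   [ord0] there. *)
rewrite le_eqVlt; apply/orP; left; apply/eqP; apply: eq_bigr => v ndv.
by rewrite kappa0 // colors_fix (negPf ndv).
Qed.

End DynamicProgramming.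

(** * Trees as unions of paths from a root *)

Definition pairs (T : Type) (s : seq T) : seq (T * T) := zip s (behead s).

Definition swap (T : Type) (u : T * T) : T * T := (u.2, u.1).

Lemma pairs_cons (T : Type) (x y : T) s :
  pairs (x :: y :: s) = (x, y) :: pairs (y :: s).
Proof. by []. Qed.

Lemma pairs_map (T U : Type) (f : T -> U) s :
  pairs (map f s) = [seq (f u.1, f u.2) | u <- pairs s].
Proof. by elim: s => // x [|y s] //= IHs; rewrite !pairs_cons /= -IHs. Qed.

Lemma pairs_rcons (T : Type) (x y : T) s :
  pairs (rcons (rcons s x) y) = rcons (pairs (rcons s x)) (x, y).
Proof. by elim: s => // z [|z' s] //= IHs; rewrite !pairs_cons IHs. Qed.

Lemma pairs_rev (T : Type) (s : seq T) :
  pairs (rev s) = rev (map (@swap T) (pairs s)).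
Proof.
elim: s => // x [|y s] // IHs.
by rewrite pairs_cons /= rev_cons [in RHS]rev_cons -IHs [rev (y :: s)]rev_cons
  pairs_rcons.
Qed.

Lemma mem_pairs (T : eqType) (u x : T) s :
  (u, x) \in pairs s -> exists s1 s2, s = s1 ++ u :: x :: s2.
Proof.
elim: s => // y [|z s] // IHs; rewrite pairs_cons inE => /orP[/eqP[-> ->]|].
  by exists [::], s.
by move=> /IHs[s1 [s2 ->]]; exists (y :: s1), s2.
Qed.

Lemma path_edgesE (V : finType) (p : seq V) :
  path_edges p = [seq [set u.1; u.2] | u <- pairs p].
Proof. by []. Qed.

Lemma traversalsE (V : finType) (p : seq V) :
  traversals p = pairs (path_edges p).
Proof. by []. Qed.

Lemma path_edges_rev (V : finType) (p : seq V) :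
  path_edges (rev p) = rev (path_edges p).
Proof.
rewrite !path_edgesE pairs_rev map_rev -map_comp; congr rev.
by apply: eq_map => u /=; rewrite setUC.
Qed.

Lemma traversals_rev (V : finType) (p : seq V) :
  traversals (rev p) = rev (map (@swap _) (traversals p)).
Proof. by rewrite !traversalsE path_edges_rev pairs_rev. Qed.

Lemma path_adjE (V : finType) (E : {set {set V}}) x p :
  path (adj E) x p = all [in E] (path_edges (x :: p)).
Proof. by elim: p x => //= y p IHp x; rewrite IHp. Qed.

Lemma adjC (V : finType) (E : {set {set V}}) : symmetric (adj E).
Proof. by move=> x y; rewrite /adj setUC. Qed.

(** * Uniqueness of predecessors on paths from the root *)

Section UniquePredecessor.
Variables (V : finType) (E : {set {set V}}) (r : V).
Hypothesis E_acyclic : acyclic E.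

Let avoid (x : V) : rel V :=
  [rel a b | [&& adj E a b, a != x & b != x]].

Lemma connect_avoid p u x :
  path (adj E) r p -> uniq (r :: p) -> (u, x) \in pairs (r :: p) ->
  [/\ connect (avoid x) r u, u != x & adj E u x].
Proof.
move=> path_p uniq_p /mem_pairs[s1 [s2 eq_p]].
have rest a s : path (adj E) a s -> x \notin a :: s -> path (avoid x) a s.
  elim: s a => //= b s IHs a /andP[ab pb].
  rewrite !inE !negb_or => /and3P[xa xb xs].
  rewrite /avoid /= ab [a == x]eq_sym xa [b == x]eq_sym xb /=.
  by apply: IHs => //; rewrite inE negb_or xb.
case: s1 eq_p => [|a s1] [eq_r eq_p]; subst.
  move: path_p uniq_p => /= /andP[-> _]; rewrite inE negb_or => /andP[/andP[]].
  by move=> ? _ _; split.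
move: path_p; rewrite cat_path /= => /and3P[path1 adj1 /andP[adj2 _]].
move: uniq_p; rewrite -cat_cons cat_uniq => /and3P[_ /hasPn disj /= /andP[]].
rewrite inE negb_or => /andP[ux _ _]; split=> //.
apply/connectP; exists (rcons s1 u); last by rewrite last_rcons.
apply: rest; first by rewrite rcons_path path1.
have /disj xs1 : x \in u :: x :: s2 by rewrite !inE eqxx orbT.
by rewrite -rcons_cons mem_rcons inE eq_sym (negPf ux).
Qed.

(* Two predecessors of x would be joined by a path avoiding x.                *)
Lemma unique_pred p p' u u' x :
  path (adj E) r p -> uniq (r :: p) -> (u, x) \in pairs (r :: p) ->
  path (adj E) r p' -> uniq (r :: p') -> (u', x) \in pairs (r :: p') ->
  u = u'.
Proof.
move=> path_p uniq_p ux path_p' uniq_p' u'x.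
have [ru u_x adj_u] := connect_avoid path_p uniq_p ux.
have [ru' u'_x adj_u'] := connect_avoid path_p' uniq_p' u'x.
have avoidC : symmetric (avoid x).
  by move=> a b; rewrite /avoid /= (adjC E a b) [(a != x) && _]andbC.
have /connectP[s0] : connect (avoid x) u u'.
  by apply: connect_trans ru'; rewrite (sym_connect_sym avoidC).
case/shortenP=> s path_s uniq_s _ eq_u'; case: s path_s uniq_s eq_u' => [|a s].
  by [].
move=> path_s uniq_s eq_u'.
(* A simple path from [u] to [u'] avoiding [x] closes up through [x] to a cycle of length at least
   3. *)
have := E_acyclic (c := [:: x, u, a & s]) isT; case/negP.
have x_s b t : path (avoid x) b t -> b != x -> x \notin b :: t.
  elim: t b => [|c t IHt] b; first by rewrite !inE eq_sym.
  move=> /= /andP[/and3P[_ _ cx] /IHt] /(_ cx) nt bx.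
  by rewrite inE negb_or eq_sym bx.
apply/andP; split; last first.
  by rewrite [uniq _]/= -/(uniq (u :: a :: s)) uniq_s (x_s _ _ path_s u_x).
rewrite /cycle rcons_path; apply/andP; split; last first.
  by rewrite (_ : last _ _ = u') // eq_u'.
apply/andP; split; first by rewrite adjC.
by apply: sub_path path_s => b c /and3P[].
Qed.

End UniquePredecessor.

(** * Parents, edges and costs in a tree that is a union of root paths *)

Section Star.
Variables (V : finType) (P : seq (seq V)) (r : V).

Let E : {set {set V}} := [set e | has (fun p => e \in path_edges p) P].

Hypothesis E_acyclic : acyclic E.
Hypothesis P_uniq : forall p, p \in P -> uniq p.
Hypothesis P_size : forall p, p \in P -> 2 < size p.
Hypothesis P_root : forall p, p \in P -> is_endpoint r p.
Hypothesis P_cover : forall v, has (fun p => v \in p) P.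

Definition starts (p : seq V) : bool := ohead p == Some r.

Definition orient (p : seq V) : seq V := if starts p then p else rev p.

Lemma mem_orient p : orient p =i p.
Proof. by rewrite /orient => x; case: ifP => // _; rewrite mem_rev. Qed.

Lemma orientE p : p \in P -> orient p = r :: behead (orient p).
Proof.
move=> /P_root; rewrite /orient /starts; case: eqP => [|_ [|]] //.
  by case: p => // x p [->].
by case: (rev p) => // x s [->].
Qed.

Lemma uniq_orient p : p \in P -> uniq (orient p).
Proof. by move=> /P_uniq; rewrite /orient; case: ifP; rewrite ?rev_uniq. Qed.

Lemma path_orient p : p \in P -> path (adj E) r (behead (orient p)).
Proof.
move=> pP; rewrite path_adjE -orientE //; apply/allP => e /= e_p.
rewrite inE; apply/hasP; exists p => //; move: e_p; rewrite /orient.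
by case: ifP => // _; rewrite path_edges_rev mem_rev.
Qed.

Definition pred_in (x : V) (q : seq V) : V := nth r q (index x q).-1.

(** Read off the first path through [x]; by [parentP] any other path gives the same vertex. The root
    is its own parent. *)
Definition parent (x : V) : V :=
  pred_in x (orient (nth [::] P (find (fun p => x \in p) P))).

Lemma pred_in_pairs x q :
  x \in q -> x != head r q -> (pred_in x q, x) \in pairs q.
Proof.
rewrite /pred_in; elim: q => // y [|z q] IHq; first by rewrite inE => /= ->.
rewrite inE /= => /orP[-> //|x_q] /negPf y_x.
rewrite eq_sym y_x pairs_cons inE /=; have [->|x_z] := eqVneq z x.
  by rewrite eqxx.
have := IHq x_q; rewrite /= eq_sym x_z => /(_ isT).
by rewrite (negPf x_z) /= => ->; rewrite orbT.
Qed.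

Lemma pairs_orient_inj p p' u u' x : p \in P -> p' \in P ->
  (u, x) \in pairs (orient p) -> (u', x) \in pairs (orient p') -> u = u'.
Proof.
move=> pP p'P; rewrite (orientE pP) (orientE p'P) => ux u'x.
apply: (unique_pred E_acyclic (path_orient pP) _ ux (path_orient p'P) _ u'x);
  by rewrite -orientE // uniq_orient.
Qed.

Lemma parentP p u x : p \in P -> (u, x) \in pairs (orient p) -> parent x = u.
Proof.
move=> pP ux; rewrite /parent.
have := P_cover x => has_x; have := nth_find [::] has_x.
set p' := nth _ _ _ => x_p'.
have p'P : p' \in P by apply: mem_nth; rewrite -has_find.
apply: (pairs_orient_inj p'P pP _ ux); apply: pred_in_pairs.
  by rewrite mem_orient.
rewrite (orientE p'P) /=; apply: contraTneq ux => ->.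
rewrite (orientE pP); apply/negP => /mem_pairs[s1 [s2 eq_s]].
have := uniq_orient pP; rewrite (orientE pP) eq_s.
case: s1 eq_s => [[<- _]|a s1 [<- _]] /=; first by rewrite !inE eqxx.
by rewrite mem_cat !inE eqxx !orbT.
Qed.

Lemma pred_in_orient p x : p \in P -> x \in p -> x != r ->
  pred_in x (orient p) = parent x.
Proof.
move=> pP xp x_r; apply/esym/(parentP pP)/pred_in_pairs.
  by rewrite mem_orient.
by rewrite (orientE pP).
Qed.

Lemma pairs_orient p : p \in P ->
  pairs (orient p) = [seq (parent x, x) | x <- behead (orient p)].
Proof.
move=> pP; have := fun u x => @parentP p u x pP.
rewrite (orientE pP) /=; move: (behead _) => s; elim: s {1 2}r => // y s IHs a.
move=> par; rewrite pairs_cons /= (par a) ?inE ?eqxx // IHs // => u x ux.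
by apply: par; rewrite pairs_cons inE ux orbT.
Qed.

Definition depth (x : V) : nat :=
  index x (orient (nth [::] P (find (fun p => x \in p) P))).

(** By induction on the position: on both paths the vertex before [x] is [parent x], until [r] is
    reached. *)
Lemma index_orient p p' x : p \in P -> p' \in P -> x \in p -> x \in p' ->
  index x (orient p) = index x (orient p').
Proof.
move=> pP p'P; rewrite -!(mem_orient p) -(mem_orient p').
move: {2}(index x (orient p)).+1 (ltnSn (index x (orient p))) => k.
elim: k x => // k IHk x ltk xp xp'.
have [->|x_r] := eqVneq x r.
  by rewrite (orientE pP) (orientE p'P) /= eqxx.
have idx_pos q : q \in P -> 0 < index x (orient q).
  by move=> qP; rewrite (orientE qP) /= eq_sym (negPf x_r).
have par_idx q : q \in P -> x \in orient q ->
    parent x \in orient q /\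
    index x (orient q) = (index (parent x) (orient q)).+1.
  move=> qP xq; have xq' : x \in q by rewrite -mem_orient.
  rewrite -(pred_in_orient qP) // /pred_in.
  have := xq; rewrite -index_mem => lt_x; have idx0 := idx_pos q qP.
  rewrite mem_nth; last by lia.
  by rewrite index_uniq ?uniq_orient //; [lia|lia].
have [px ix] := par_idx p pP xp; have [px' ix'] := par_idx p' p'P xp'.
by rewrite ix ix' (IHk (parent x)) //; lia.
Qed.

Lemma depth_index p x : p \in P -> x \in p -> depth x = index x (orient p).
Proof.
move=> pP xp; have has_x := P_cover x; rewrite /depth.
apply: index_orient => //; last exact: (nth_find [::] has_x).
by apply: mem_nth; rewrite -has_find.
Qed.

Lemma depth_lt x : depth x < #|V|.
Proof.
have /hasP[p pP xp] := P_cover x; rewrite (depth_index pP xp).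
have := xp; rewrite -mem_orient -index_mem => /leq_trans; apply.
by rewrite -(card_uniqP (uniq_orient pP)) max_card.
Qed.

Lemma depth_parent x : x != r -> depth (parent x) < depth x.
Proof.
move=> x_r; have /hasP[p pP xp] := P_cover x.
have xq : x \in orient p by rewrite mem_orient.
have idx0 : 0 < index x (orient p).
  by rewrite (orientE pP) /= eq_sym (negPf x_r).
have lt_x : index x (orient p) < size (orient p) by rewrite index_mem.
rewrite (depth_index pP xp) -(pred_in_orient pP xp x_r).
have lt_px : (index x (orient p)).-1 < size (orient p) by lia.
rewrite (@depth_index p) // /pred_in; last by rewrite -mem_orient mem_nth.
by rewrite index_uniq ?uniq_orient //; lia.
Qed.

Definition pedge (x : V) : {set V} := [set parent x; x].

Lemma path_edges_orient p : p \in P ->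
  path_edges (orient p) = map pedge (behead (orient p)).
Proof. by move=> pP; rewrite path_edgesE pairs_orient // -map_comp. Qed.

Lemma edgesP e : reflect (exists2 x, x != r & e = pedge x) (e \in E).
Proof.
have edge_orient p : path_edges (orient p) =i path_edges p.
  move=> f; rewrite /orient; case: ifP => // _.
  by rewrite path_edges_rev mem_rev.
rewrite inE; apply: (iffP hasP) => [[p pP]|[x x_r ->]].
  rewrite -edge_orient path_edges_orient // => /mapP[x xp ->]; exists x => //.
  have := uniq_orient pP; rewrite (orientE pP) /= => /andP[r_p _].
  by apply: contraNneq r_p => <-.
have /hasP[p pP xp] := P_cover x; exists p => //.
rewrite -edge_orient path_edges_orient //; apply: map_f.
by move: xp; rewrite -mem_orient (orientE pP) inE (negPf x_r).
Qed.

(** Distinct vertices sharing their parent edge would be parents of each other, against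
    [depth_parent]. *)
Lemma pedge_inj x y : x != r -> y != r -> pedge x = pedge y -> x = y.
Proof.
move=> x_r y_r eq_xy; apply/eqP; apply: contraT => x_y.
have /set2P[x_py|eqxy] : x \in pedge y by rewrite -eq_xy !inE eqxx orbT.
  2: by rewrite eqxy eqxx in x_y.
have /set2P[y_px|eqxy] : y \in pedge x by rewrite eq_xy !inE eqxx orbT.
  2: by rewrite eqxy eqxx in x_y.
by have := depth_parent x_r; have := depth_parent y_r; rewrite -x_py -y_px; lia.
Qed.

Lemma degree_children v :
  #|[set x | (x != r) && (parent x == v)]| <= degree E v.
Proof.
rewrite -(card_in_imset (f := pedge)); last first.
  move=> x y; rewrite !inE => /andP[x_r _] /andP[y_r _]; exact: pedge_inj.
apply: subset_leq_card; apply/subsetP => e /imsetP[x].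
rewrite inE => /andP[x_r /eqP <-] ->; rewrite inE; apply/andP; split.
  by apply/edgesP; exists x.
by rewrite !inE eqxx.
Qed.

Lemma proper_star (X : Type) (chi : {set V} -> X) :
  Defs.proper E chi <->
  (forall x, x != r -> parent x != r -> chi (pedge (parent x)) <> chi (pedge x))
  /\ (forall x y, x != r -> y != r -> parent x = parent y ->
        chi (pedge x) = chi (pedge y) -> x = y).
Proof.
split=> [chi_proper|[chi_par chi_sib] e f /edgesP[x x_r ->] /edgesP[y y_r ->]].
  have pE x : x != r -> pedge x \in E by move=> x_r; apply/edgesP; exists x.
  split=> [x x_r px_r|x y x_r y_r eq_par eq_chi].
    apply: chi_proper; rewrite ?pE //.
      apply/eqP => /(pedge_inj px_r x_r) px_x.
      by have := depth_parent x_r; rewrite px_x ltnn.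
    by apply/set0Pn; exists (parent x); rewrite !inE eqxx orbT.
  apply/eqP; apply: contraT => x_y; case: (chi_proper (pedge x) (pedge y)).
  - exact: pE.
  - exact: pE.
  - by apply: contraNneq x_y => /pedge_inj->.
  - by apply/set0Pn; exists (parent x); rewrite !inE eqxx eq_par eqxx.
  - by [].
move=> xy /set0Pn[z]; rewrite !inE => /andP[/orP[]/eqP-> /orP[]/eqP] eq_xy.
- by move=> /(chi_sib _ _ x_r y_r eq_xy) eqxy; rewrite eqxy eqxx in xy.
- by have := chi_par x x_r; rewrite eq_xy y_r => /(_ isT) H /esym.
- by have := chi_par y y_r; rewrite -eq_xy x_r => /(_ isT).
- by rewrite eq_xy eqxx in xy.
Qed.

(** The vertices whose parent edge has a parent edge in turn, that is, those at the lower end of a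
    traversal. *)
Definition inner (x : V) : bool := (x != r) && (parent x != r).

Lemma traversals_orient p : p \in P -> traversals (orient p) =
  [seq (pedge (parent x), pedge x) | x <- orient p & inner x].
Proof.
move=> pP; rewrite traversalsE path_edges_orient // pairs_map.
have := pairs_orient pP; have := uniq_orient pP; have := P_size pP.
have -> : size p = size (orient p).
  by rewrite /orient; case: ifP; rewrite ?size_rev.
rewrite (orientE pP); case: (behead _) => [|a s] //= _.
rewrite pairs_cons => /and3P[r_as _ _] [par_a eq_s]; rewrite eq_s -map_comp.
rewrite /inner eqxx /= -par_a eqxx andbF; congr map.
apply/esym/all_filterP/allP => x xs; apply/andP; split.
  by apply: contraNneq r_as => <-; rewrite inE xs orbT.
have : (parent x, x) \in pairs (a :: s) by rewrite eq_s map_f.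
case/mem_pairs=> s1 [s2 eq_as]; apply: contraNneq r_as => <-.
by rewrite eq_as mem_cat inE eqxx orbT.
Qed.

Lemma sum_traversals (F : zmodType) (p : seq V)
    (f : {set V} * {set V} -> F) :
  p \in P -> (forall t, f (swap t) = f t) ->
  (\sum_(t <- traversals p) f t =
   \sum_(x | inner x && (x \in p)) f (pedge (parent x), pedge x))%R.
Proof.
move=> pP f_swap.
transitivity (\sum_(t <- traversals (orient p)) f t)%R.
  rewrite /orient; case: ifP => // _; rewrite traversals_rev.
  rewrite (perm_big _ (permEl (perm_rev _))) big_map.
  by apply: eq_bigr => t _; rewrite f_swap.
rewrite traversals_orient // big_map big_filter -big_filter.
rewrite big_uniq ?filter_uniq ?uniq_orient //=.
by apply: eq_bigl => x; rewrite mem_filter mem_orient.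
Qed.

(** The multiplicity of the traversal at [x], written as a sum of copies of [c] because the machine
    cannot multiply. For [MINCC] it can be 2: traversals are ordered pairs, so one used by a path
    starting at [r] and by a path ending at [r] is counted in each direction. *)
Definition weight (F : zmodType) (pb : problem) (x : V) (c : F) : F :=
  (match pb with
   | MINRC => \sum_(p <- P | x \in p) c
   | MINCC => (if has (fun p => starts p && (x \in p)) P then c else 0) +
              (if has (fun p => ~~ starts p && (x \in p)) P then c else 0)
   end)%R.

Lemma sum_reload (F : zmodType) (f : {set V} * {set V} -> F) :
  (forall t, f (swap t) = f t) ->
  (\sum_(p <- P) \sum_(t <- traversals p) f t =
   \sum_(x | inner x) weight MINRC x (f (pedge (parent x), pedge x)))%R.
Proof.
move=> f_swap; rewrite big_seq.
rewrite (eq_bigr (fun p => \sum_(x | inner x && (x \in p))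
  f (pedge (parent x), pedge x))%R); last first.
  by move=> p pP; apply: sum_traversals.
rewrite -big_seq (exchange_big_dep inner) /=; last by move=> p x _ /andP[].
by apply: eq_bigr => x inx; apply: eq_bigl => p; rewrite inx.
Qed.

(** The set of traversals splits into downward ones, from paths starting at [r], and upward ones,
    from the others. Comparing depths shows that no pair is of both kinds. *)
Lemma sum_changeover (F : zmodType) (f : {set V} * {set V} -> F) :
  (forall t, f (swap t) = f t) ->
  (\sum_(t in [set t | has (fun p => t \in traversals p) P]) f t =
   \sum_(x | inner x) weight MINCC x (f (pedge (parent x), pedge x)))%R.
Proof.
move=> f_swap; pose ft x := (pedge (parent x), pedge x).
pose X (b : bool) := [set x | inner x &&
  has (fun p => (starts p == b) && (x \in p)) P].
have inner_r x : inner x -> x != r by case/andP.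
have ft_inj b : {in X b &, injective ft}.
  move=> x y; rewrite !inE => /andP[/inner_r x_r _] /andP[/inner_r y_r _].
  by case=> _; apply: pedge_inj.
have fts_inj b : {in X b &, injective (@swap _ \o ft)}.
  by move=> x y Xx Xy [eq1 eq2]; apply: (ft_inj b) => //; rewrite /ft eq1 eq2.
set theta := [set t | _]; set A := ft @: X true.
set B := (@swap _ \o ft) @: X false.
have mem_trav t p : t \in traversals p =
    ((if starts p then t else swap t) \in traversals (orient p)).
  rewrite /orient; case: ifP => // _; rewrite traversals_rev mem_rev mem_map //.
  by move=> [a b] [c d] [-> ->].
have thetaE : theta = A :|: B.
  apply/setP => t; rewrite inE in_setU; apply/hasP/orP => [[p pP]|].
    rewrite mem_trav traversals_orient // => /mapP[x].
    rewrite mem_filter mem_orient => /andP[inx xp] eq_t.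
    have Xx : x \in X (starts p).
      by rewrite inE inx; apply/hasP; exists p; rewrite ?eqxx.
    move: eq_t Xx; case: (starts p) => eq_t Xx; [left|right].
      by rewrite eq_t; apply: (imset_f ft).
    have -> : t = swap (ft x) by rewrite /ft -eq_t; case: (t).
    exact: (imset_f (@swap _ \o ft)).
  case=> /imsetP[x]; rewrite inE => /andP[inx /hasP[p pP /andP[/eqP st xp]]] ->.
    exists p => //; rewrite mem_trav st traversals_orient //.
    by apply: map_f; rewrite mem_filter inx mem_orient.
  exists p => //; rewrite mem_trav st traversals_orient //.
  by apply: (map_f ft); rewrite mem_filter inx mem_orient.
have disj : [disjoint B & A].
  apply/pred0P => t /=; apply/negbTE/andP => -[/imsetP[x Xx ->] /imsetP[y Xy]].
  move: Xx Xy; rewrite !inE.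
  move=> /andP[/andP[x_r px_r] _] /andP[/andP[y_r py_r] _].
  case=> /(pedge_inj x_r py_r) eq_x /(pedge_inj px_r y_r) eq_y.
  have := depth_parent x_r; have := depth_parent y_r.
  by rewrite eq_y -eq_x; lia.
rewrite (big_setID A) /= thetaE setUK setDUl setDv set0U (setDidPl disj).
rewrite !big_imset; [|exact: fts_inj|exact: ft_inj].
rewrite /weight big_split /= -!big_mkcondr; congr (_ + _)%R.
  apply: eq_big => [x|x _] //; rewrite inE; congr (_ && _).
  by apply: eq_has => p; rewrite eqb_id.
apply: eq_big => [x|x _]; last by rewrite /= f_swap.
by rewrite inE; congr (_ && _); apply: eq_has => p; rewrite eqbF_neg.
Qed.

End Star.

(** * The program *)

Section ReadInstance.
Variables (F : realDomainType) (n : nat).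
Local Notation J := 'I_n.+1.

(** Terms have no recursion on lists: a fold is n + 1 rounds, each consuming one element and idling
    once the list is empty. *)
Definition lfold (A B : Type) (f : A -> B -> B) (b : B) (l : seq A) : B :=
  (iterJ n (fun st => match st.1 with
                      | [::] => st
                      | a :: l' => (l', f a st.2)
                      end) (l, b)).2.

Definition startsJ (r : J) (p : seq J) : bool :=
  match p with [::] => false | x :: _ => eqJ x r end.

Definition revJ (p : seq J) : seq J := lfold (fun x s => x :: s) [::] p.

Definition orientJ (r : J) (p : seq J) : seq J :=
  if startsJ r p then p else revJ p.

Definition memJ (x : J) (p : seq J) : bool :=
  lfold (fun y b => eqJ y x || b) false p.

Definition predJ (x : J) (q : seq J) : J :=
  (lfold (fun y st => (y, if eqJ y x then st.1 else st.2)) (ord0, ord0) q).2.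

(** The root is not part of the input, so any index at which all paths end is searched for; it may
    differ from the vertex assumed to exist. *)
Definition rootJ (P : seq (seq J)) : J :=
  find1 (fun r => lfold
    (fun p b => (startsJ r p || startsJ r (revJ p)) && b) true P).

Definition parJ (P : seq (seq J)) (r x : J) : J :=
  lfold (fun p u => if memJ x p then predJ x (orientJ r p) else u) ord0 P.

(** Exactly i of the rounds, those with k < i, remove an element. *)
Definition nthJ (A : Type) (a : A) (l : seq A) (i : J) : A :=
  match foldr (fun (k : J) (l' : seq A) => if i <= k then l' else
      match l' with [::] => l' | _ :: l'' => l'' end) l (enum J)
  with [::] => a | x :: _ => x end.

Definition tcJ (c : seq (seq F)) (i j : J) : F :=
  nthJ 0%R (nthJ [::] c i) j.

Definition weightJ (pb : problem) (P : seq (seq J)) (r x : J) (c : F) : F :=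
  (match pb with
   | MINRC => lfold (fun p s => if memJ x p then c + s else s) 0 P
   | MINCC =>
      (if lfold (fun p b => (startsJ r p && memJ x p) || b) false P
       then c else 0) +
      (if lfold (fun p b => (~~ startsJ r p && memJ x p) || b) false P
       then c else 0)
   end)%R.

Definition cstJ pb (P : seq (seq J)) (c : seq (seq F)) (r x i j : J) : F :=
  if eqJ (parJ P r x) r then 0%R else weightJ pb P r x (tcJ c i j).

Definition ndJ (nv r x : J) : bool := ~~ (nv <= x) && ~~ eqJ x r.

(** There is no edge above the root, so the placeholder color at the root forbids nothing. *)
Definition colsJ (nc r v i j : J) : bool :=
  ~~ (nc <= j) && (eqJ v r || ~~ eqJ j i).

Definition outJ (nd : J -> bool) (par kappa : J -> J) :
    seq (J * (J * (J * unit))) :=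
  foldr (fun x s => if nd x then (par x, (x, (kappa x, tt))) :: s else s)
    [::] (enum J).

Definition solve pb (inp : J * (J * (seq (seq J) * (seq (seq F) * unit)))) :
    seq (J * (J * (J * unit))) :=
  let r := rootJ inp.2.2.1 in
  let nd := ndJ inp.1 r in
  let par := parJ inp.2.2.1 r in
  outJ nd par
    (colors nd par (colsJ inp.2.1 r) (cstJ pb inp.2.2.1 inp.2.2.2.1 r)).

End ReadInstance.

(** * The program as a term, with de Bruijn variables as projections *)

Definition tid A : tm A A := Op (OId A).
Definition v0 A B : tm (TPair A B) A := Op (OFst A B).
Definition wk A B C (t : tm B C) : tm (TPair A B) C := Comp (Op (OSnd A B)) t.
Definition tfst A B C (t : tm A (TPair B C)) : tm A B := Comp t (Op (OFst B C)).
Definition tsnd A B C (t : tm A (TPair B C)) : tm A C := Comp t (Op (OSnd B C)).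
Definition tlet A B C (t : tm A B) (u : tm (TPair B A) C) : tm A C :=
  Comp (Pair t (tid A)) u.
Arguments wk {A B C}.
Arguments tid {A}.
Arguments v0 {A B}.
Notation wk4 t := (wk (wk (wk (wk t)))).
Notation v1 := (wk v0).
Notation v2 := (wk v1).
Notation v3 := (wk v2).
Notation v4 := (wk v3).
Notation v5 := (wk v4).
Notation v6 := (wk v5).
Notation v7 := (wk v6).

Definition ttrue {A} : tm A TBool := Op (OTrue A).
Definition tfalse {A} : tm A TBool := Op (OFalse A).
Definition tand A (t u : tm A TBool) : tm A TBool := Ite t u tfalse.
Definition tor A (t u : tm A TBool) : tm A TBool := Ite t ttrue u.
Definition tnot A (t : tm A TBool) : tm A TBool := Ite t tfalse ttrue.
Definition tidx0 {A} : tm A TIdx := Op (OIdx0 A).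
Definition tleq A (t u : tm A TIdx) : tm A TBool := Comp (Pair t u) Leq.
Definition teq A (t u : tm A TIdx) : tm A TBool := tand (tleq t u) (tleq u t).
Definition tget A B (t : tm A (TTab B)) (i : tm A TIdx) : tm A B :=
  Comp (Pair t i) (Get B).
Definition tget2 A B (t : tm A (TTab (TTab B))) (i j : tm A TIdx) : tm A B :=
  tget (tget t i) j.
Definition tzero {A} : tm A TNum := Op (OZero A).
Definition tadd A (t u : tm A TNum) : tm A TNum := Comp (Pair t u) (Op OAdd).
Definition tsub A (t u : tm A TNum) : tm A TNum := Comp (Pair t u) (Op OSub).
Definition tle A (t u : tm A TNum) : tm A TBool := Comp (Pair t u) (Op OLe).
Definition tnil {A B} : tm A (TList B) := Op (ONil A B).
Definition tcons A B (t : tm A B) (l : tm A (TList B)) : tm A (TList B) :=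
  Comp (Pair t l) (Op (OCons B)).

Definition titer A B (t : tm A B) (u : tm (TPair B A) B) : tm A B :=
  Loop t (wk u).

Definition tfind A (t : tm (TPair TIdx A) TBool) : tm A TIdx :=
  Loop tidx0 (Ite (Comp (Pair v0 (wk (wk tid))) t) v0 v1).

Definition targm A (P : tm A (TTab (TTab TBool)))
    (M : tm A (TTab (TTab TNum))) : tm A (TPair TIdx TIdx) :=
  Loop (Pair tidx0 tidx0)
    (Loop v1
      (Ite (tand (tget2 (wk4 P) v2 v0)
             (tor (tnot (tget2 (wk4 P) (tfst v1) (tsnd v1)))
                  (tle (tget2 (wk4 M) v2 v0)
                       (tget2 (wk4 M) (tfst v1) (tsnd v1)))))
         (Pair v2 v0) v1)).

Definition tlfold A B C (f : tm (TPair B (TPair C A)) C) (t : tm A C)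
    (l : tm A (TList B)) : tm A C :=
  tsnd (titer (Pair l t)
    (LCase (tfst v0) v0
       (Pair v1 (Comp (Pair v0 (Pair (tsnd v2) (wk (wk (wk tid))))) f)))).

Notation TTabB := (TTab TBool).
Notation TTabI := (TTab TIdx).
Notation TTabN2 := (TTab (TTab TNum)).

Definition THungState : ty :=
  TPair TTabN2 (TPair TTabB (TPair TTabB (TPair (TTab TTabI)
    (TPair TBool TTabI)))).

(* Environment: state, columns, matched rows, current matching. *)
Definition t_hstep :
    tm (TPair THungState (TPair TTabB (TPair TTabB TTabI))) THungState :=
  Ite (tfst (tsnd (tsnd (tsnd (tsnd v0))))) v0
  (tlet
    (targm (Tab (Tab (tand (tget (tfst (tsnd v2)) v1)
                       (tand (tget v3 v0)
                             (tnot (tget (tfst (tsnd (tsnd v2))) v0))))))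
           (tfst v0))
  (tlet
    (Tab (Tab
      (let M := tfst v3 in
       let Mij := tget2 M v1 v0 in
       let d := tget2 M (tfst v2) (tsnd v2) in
       let Tj := tget (tfst (tsnd (tsnd v3))) v0 in
       Ite (tget (tfst (tsnd v3)) v1)
         (Ite Tj Mij (tsub Mij d))
         (Ite Tj (tadd Mij d) Mij))))
  (tlet
    (Tab (Ite (teq v0 (tfst v2)) (tsnd v2)
              (tget2 (tfst (tsnd (tsnd (tsnd v3)))) (tfst v2) v0)))
  (tlet
    (tfind (tand (tget v6 v0)
                 (teq (tget (wk (wk (wk (wk (wk (wk (wk tid))))))) v0)
                      (tsnd v3))))
  (* o, psi, M', ij, state, columns, matched rows, current matching *)
  (let S := tfst (tsnd v4) in
   let T := tfst (tsnd (tsnd v4)) in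
   let m := tfst (tsnd (tsnd (tsnd v4))) in
   let R := v6 in
   let phi := wk (wk (wk (wk (wk (wk (wk tid)))))) in
   Ite (tand (tget R v0) (teq (tget phi v0) (tsnd v3)))
     (Pair v2 (Pair (Tab (tor (teq v0 v1) (tget (wk S) v0)))
       (Pair (Tab (tor (teq v0 (tsnd v4)) (tget (wk T) v0)))
         (Pair (Tab (Ite (teq v0 v1) v2 (tget (wk m) v0)))
           (Pair tfalse phi)))))
     (Pair v2 (Pair S (Pair T (Pair m (Pair ttrue v1)))))))))).

(* Environment: columns, rows, costs. *)
Definition t_assignment : tm (TPair TTabB (TPair TTabB TTabN2)) TTabI :=
  tsnd (tsnd (Loop
    (Pair (wk (wk tid)) (Pair (Tab tfalse) (Tab tidx0)))
    (* x, accumulator, columns, rows, costs *)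
    (let R := tfst (tsnd v1) in
     let phi := tsnd (tsnd v1) in
     Ite (tget v3 v0)
       (tlet
         (titer (Pair (tfst v1) (Pair (Tab (teq v0 v1)) (Pair (Tab tfalse)
                  (Pair (Tab (wk phi)) (Pair tfalse phi)))))
            (Comp (Pair v0 (Pair v3 (Pair (wk R) (wk phi)))) t_hstep))
         (Pair (tfst v0) (Pair (Tab (tor (teq v0 v2) (tget (wk (wk R)) v0)))
                            (tsnd (tsnd (tsnd (tsnd (tsnd v0))))))))
       v1))).

Notation TDP :=
  (TPair TTabB (TPair TTabI (TPair (TTab (TTab TTabB)) (TTab TTabN2)))).

Definition tchild A (D : tm A TDP) (v x : tm A TIdx) : tm A TBool :=
  tand (tget (tfst D) x) (teq (tget (tfst (tsnd D)) x) v).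

Definition tcols A (D : tm A TDP) : tm A (TTab (TTab TTabB)) :=
  tfst (tsnd (tsnd D)).

Definition tcst A (D : tm A TDP) (x i j : tm A TIdx) : tm A TNum :=
  tget2 (tget (tsnd (tsnd (tsnd D))) x) i j.

(* Environment: values, v, i, data. *)
Definition t_choice : tm (TPair TTabN2 (TPair TIdx (TPair TIdx TDP))) TTabI :=
  Comp (Pair (tget2 (tcols (wk (wk (wk tid)))) v1 v2)
       (Pair (Tab (tchild (wk4 tid) v2 v0))
         (Tab (Tab (Ite (tchild (wk (wk (wk (wk (wk tid))))) v3 v1)
           (tadd (tcst (wk (wk (wk (wk (wk tid))))) v1 v4 v0)
                 (tget2 v2 v1 v0))
           tzero)))))
    t_assignment.

Definition t_values : tm TDP TTabN2 :=
  titer (Tab (Tab tzero))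
    (Tab (Tab
      (* i, v, values, data *)
      (tlet (Comp (Pair v2 (Pair v1 (Pair v0 (wk (wk (wk tid)))))) t_choice)
        (Loop tzero
          (* x, sum, choice, i, v, values, data *)
          (let D := wk (wk (wk (wk (wk (wk tid))))) in
           Ite (tchild D v4 v0)
             (tadd (tadd (tcst D v0 v3 (tget v2 v0))
                         (tget2 v5 v0 (tget v2 v0))) v1)
             v1))))).

Definition t_colors : tm TDP TTabI :=
  tlet t_values
    (titer (Tab tidx0)
      (* x, colors, values, data *)
      (Tab (Ite (tget v3 v0)
             (let px := tget v4 v0 in
              tget (Comp (Pair v2 (Pair px (Pair (tget v1 px)
                     (wk (wk (wk tid)))))) t_choice) v0)
             tidx0))).

(* Environment: root, path. *)
Definition t_starts : tm (TPair TIdx (TList TIdx)) TBool :=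
  LCase (tsnd tid) tfalse (teq v0 v2).

Definition t_rev : tm (TList TIdx) (TList TIdx) :=
  tlfold (tcons v0 v1) tnil tid.

(* Environment: root, path. *)
Definition t_orient : tm (TPair TIdx (TList TIdx)) (TList TIdx) :=
  Ite t_starts (tsnd tid) (Comp (tsnd tid) t_rev).

(* Environment: vertex, path. *)
Definition t_mem : tm (TPair TIdx (TList TIdx)) TBool :=
  tlfold (tor (teq v0 v2) v1) tfalse (tsnd tid).

Definition t_pred : tm (TPair TIdx (TList TIdx)) TIdx :=
  tsnd (tlfold (Pair v0 (Ite (teq v0 v2) (tfst v1) (tsnd v1)))
          (Pair tidx0 tidx0) (tsnd tid)).

Definition t_root : tm (TList (TList TIdx)) TIdx :=
  tfind (tlfold
    (tand (tor (Comp (Pair v2 v0) t_starts)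
               (Comp (Pair v2 (Comp v0 t_rev)) t_starts)) v1)
    ttrue (wk tid)).

(* Environment: paths, root, vertex. *)
Definition t_par : tm (TPair (TList (TList TIdx)) (TPair TIdx TIdx)) TIdx :=
  let x := wk (wk (wk (wk tid))) in
  tlfold (Ite (Comp (Pair x v0) t_mem)
              (Comp (Pair x (Comp (Pair v3 v0) t_orient)) t_pred) v1)
    tidx0 v0.

Definition t_nth A (d : tm (TPair (TList A) TIdx) A) :
    tm (TPair (TList A) TIdx) A :=
  LCase (Loop v0 (Ite (tleq (wk (wk (wk tid))) v0) v1 (LCase v1 v1 v1))) d v0.

(* Environment: paths, root, vertex, cost. *)
Definition t_weight (pb : problem) :
    tm (TPair (TList (TList TIdx)) (TPair TIdx (TPair TIdx TNum))) TNum :=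
  let c := wk (wk (wk tid)) in
  match pb with
  | MINRC =>
      tlfold (Ite (Comp (Pair v4 v0) t_mem)
                  (tadd (wk (wk c)) v1) v1) tzero v0
  | MINCC =>
      tadd
        (Ite (tlfold (tor (tand (Comp (Pair v3 v0) t_starts)
                                (Comp (Pair v4 v0) t_mem)) v1)
                tfalse v0) c tzero)
        (Ite (tlfold (tor (tand (tnot (Comp (Pair v3 v0) t_starts))
                                (Comp (Pair v4 v0) t_mem)) v1)
                tfalse v0) c tzero)
  end.

Definition TInput : ty := TPair TIdx (TPair TIdx
  (TPair (TList (TList TIdx)) (TPair (TList (TList TNum)) TUnit))).

Definition TOutput : ty :=
  TList (TPair TIdx (TPair TIdx (TPair TIdx TUnit))).

Definition t_solve (pb : problem) : tm TInput TOutput :=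
  tlet (Comp v2 t_root)
  (* root, input *)
  (tlet
    (Pair (Tab (tand (tnot (tleq v2 v0)) (tnot (teq v0 v1))))
    (Pair (Tab (Comp (Pair v4 (Pair v1 v0)) t_par))
    (Pair
      (* j, i, v, root, input *)
      (Tab (Tab (Tab (tand (tnot (tleq v5 v0))
                           (tor (teq v2 v3) (tnot (teq v0 v1)))))))
      (* j, i, x, root, input *)
      (Tab (Tab (Tab
        (Ite (teq (Comp (Pair v6 (Pair v3 v2)) t_par) v3) tzero
          (Comp (Pair v6 (Pair v3 (Pair v2
             (Comp (Pair (Comp (Pair v7 v1) (t_nth tnil)) v0) (t_nth tzero)))))
             (t_weight pb)))))))))
  (tlet (Comp v0 t_colors)
    (Loop tnil
      (* x, list, colors, data *)
      (Ite (tget (tfst v3) v0)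
        (tcons (Pair (tget (tfst (tsnd v3)) v0)
                  (Pair v0 (Pair (tget v2 v0) (Op (OUnit _)))))
               v1)
        v1)))).

(** Holds by conversion, since the term mirrors [solve] construct by construct. *)
Lemma t_solveE (F : realDomainType) n pb inp :
  den (t_solve pb) inp = @solve F n pb inp.
Proof. case: pb; reflexivity. Qed.

(** * Correctness of the program *)

Lemma lfoldE n (A B : Type) (f : A -> B -> B) b (l : seq A) :
  size l <= n.+1 -> lfold n f b l = foldl (fun c a => f a c) b l.
Proof.
rewrite /lfold iterJE; move: n.+1 => m; elim: l m b => [|a l IHl] m b.
  by move=> _; elim: m => // m IHm; rewrite iterSr.
by case: m => // m lem; rewrite iterSr /= IHl.
Qed.

Lemma foldl_has (A : Type) (a : A -> bool) b l :
  foldl (fun c x => a x || c) b l = has a l || b.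
Proof. by elim: l b => //= x l IHl b; rewrite IHl orbCA orbA. Qed.

Lemma foldl_all (A : Type) (a : A -> bool) b l :
  foldl (fun c x => a x && c) b l = all a l && b.
Proof. by elim: l b => //= x l IHl b; rewrite IHl andbCA andbA. Qed.

Lemma foldl_sum (F : nmodType) (A : Type) (a : A -> bool) (c s : F) l :
  (foldl (fun s x => if a x then c + s else s) s l =
   \sum_(x <- l | a x) c + s)%R.
Proof.
elim: l s => [|x l IHl] s; rewrite ?big_nil ?add0r // big_cons /= IHl.
by case: (a x); rewrite // addrA [(c + _)%R]addrC.
Qed.

Lemma foldl_cons (A : Type) (s l : seq A) :
  foldl (fun s x => x :: s) s l = catrev l s.
Proof. by elim: l s => //= x l IHl s; rewrite IHl. Qed.

Lemma foldl_cst (A : eqType) (B : Type) (a : A -> bool) (f : A -> B) b c l :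
  has a l -> (forall x, x \in l -> a x -> f x = c) ->
  foldl (fun u x => if a x then f x else u) b l = c.
Proof.
move=> has_a fc.
suff: forall u, (has a l \/ u = c) ->
    foldl (fun u x => if a x then f x else u) u l = c by apply; left.
elim: l fc {has_a} => [_ u [] //|x l IHl] fc u /= H.
apply: IHl; first by move=> y yl; apply: fc; rewrite inE yl orbT.
case: H => [/orP[ax|]|->]; [right|by left|right].
  by rewrite ax fc ?inE ?eqxx.
by case: ifP => // ax; rewrite fc ?inE ?eqxx.
Qed.

Lemma foldl_pred (A : eqType) (x a b : A) q :
  uniq q -> x \in q ->
  (foldl (fun st y => (y, if y == x then st.1 else st.2)) (a, b) q).2 =
  nth a (a :: q) (index x q).
Proof.
have notin c d (s : seq A) : x \notin s ->
    (foldl (fun st y => (y, if y == x then st.1 else st.2)) (c, d) s).2 = d.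
  elim: s c d => //= y s IHs c d; rewrite inE negb_or eq_sym => /andP[/negPf->].
  exact: IHs.
elim: q a b => // y q IHq a b /= /andP[yq uq]; rewrite inE eq_sym.
have [eq_yx _|_ /= xq] := eqVneq y x; first by rewrite notin // -eq_yx.
by rewrite IHq //=; apply: set_nth_default; rewrite /= ltnS index_size.
Qed.

Lemma count_ltn_iota k m : k <= m -> count (fun j => j < k) (iota 0 m) = k.
Proof.
move=> /subnKC <-; rewrite iotaD count_cat add0n.
have /eqP-> : count (fun j => j < k) (iota 0 k) == k.
  rewrite -[X in _ == X](size_iota 0 k) -all_count.
  by apply/allP => j; rewrite mem_iota.
rewrite (eq_in_count (a2 := pred0)) ?count_pred0 ?addn0 // => j.
by rewrite mem_iota => /andP[lekj _]; rewrite ltnNge lekj.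
Qed.

Section IndexLists.
Variable n : nat.
Local Notation J := 'I_n.+1.

Lemma revJE (p : seq J) : size p <= n.+1 -> revJ p = rev p.
Proof. by move=> le_p; rewrite /revJ lfoldE // foldl_cons. Qed.

Lemma memJE (x : J) p : size p <= n.+1 -> memJ x p = (x \in p).
Proof.
move=> le_p; rewrite /memJ lfoldE // foldl_has orbF -has_pred1.
by apply: eq_has => y /=; rewrite eqJE.
Qed.

Lemma startsJE (r : J) p : startsJ r p = starts r p.
Proof. by case: p => //= x p; rewrite eqJE. Qed.

Lemma rootJP (P : seq (seq J)) r :
  size P <= n.+1 -> (forall p, p \in P -> size p <= n.+1) ->
  (forall p, p \in P -> is_endpoint r p) ->
  forall p, p \in P -> is_endpoint (rootJ P) p.
Proof.
move=> le_P le_p r_end p pP; rewrite /rootJ; set a := fun r : J => _.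
have aE s : a s = all (fun p => starts s p || starts s (rev p)) P.
  rewrite /a lfoldE // foldl_all andbT; apply: eq_in_all => q qP.
  by rewrite !startsJE revJE ?le_p.
have /(find1P (P := a)) : a r.
  rewrite aE; apply/allP => q /r_end; rewrite /starts => -[->|->].
    by rewrite eqxx.
  by rewrite eqxx orbT.
by rewrite aE => /allP/(_ p pP)/orP[/eqP|/eqP]; [left|right].
Qed.

Lemma nthJE (A : Type) (a : A) l (i : J) : nthJ a l i = nth a l i.
Proof.
rewrite /nthJ; suff -> : foldr (fun (k : J) (l' : seq A) => if i <= k then l'
    else match l' with [::] => l' | _ :: l'' => l'' end) l (enum J) = drop i l.
  by rewrite -[in RHS](addn0 i) -nth_drop; case: (drop i l).
have cnt : count (fun k : J => k < i) (enum J) = i.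
  rewrite -(count_map val (fun k => k < i)) val_enum_ord.
  exact/count_ltn_iota/ltnW.
rewrite -[X in drop X]cnt.
elim: (enum J) => [|k s IHs] /=; first by rewrite drop0.
rewrite IHs ltnNge; case: (i <= k) => //=.
set m := count _ _; rewrite -(drop_drop l 1 m).
by case: (drop _ l) => //= x l'; rewrite drop0.
Qed.

End IndexLists.

(** Large enough for [nvert I] and [ncol I] to be indices themselves, and for n + 1 rounds to
    exhaust the list of paths and each path. *)
Definition fuel (F : Type) (I : instance F) : nat :=
  nvert I + ncol I + size (paths I).

(** * From an instance to the dynamic program and back *)

Section Instance.
Variables (F : realDomainType) (pb : problem) (I : instance F).
Local Notation V := 'I_(nvert I).
Local Notation n := (fuel I).
Local Notation J := 'I_n.+1.

Lemma nvert_le : nvert I <= n.+1.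
Proof. by rewrite /fuel; lia. Qed.

Lemma ncol_le : ncol I <= n.+1.
Proof. by rewrite /fuel; lia. Qed.

Definition jv : V -> J := widen_ord nvert_le.
Definition jc : 'I_(ncol I) -> J := widen_ord ncol_le.

Lemma jv_inj : injective jv.
Proof. by move=> x y /(congr1 val) /= /val_inj. Qed.

Lemma jc_inj : injective jc.
Proof. by move=> x y /(congr1 val) /= /val_inj. Qed.

Lemma nvert_lt : nvert I < n.+1.
Proof. by rewrite /fuel; lia. Qed.

Lemma ncol_lt : ncol I < n.+1.
Proof. by rewrite /fuel; lia. Qed.

Definition jpaths : seq (seq J) := [seq [seq jv v | v <- p] | p <- paths I].

Definition jcosts : seq (seq F) :=
  [seq [seq tc i j | j <- enum 'I_(ncol I)] | i <- enum 'I_(ncol I)].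

Definition input : sem F n TInput :=
  (Ordinal nvert_lt, (Ordinal ncol_lt, (jpaths, (jcosts, tt)))).

Lemma vof_input : vof input = enc_instance I.
Proof.
rewrite /vof /= /enc_instance /jpaths /jcosts -!map_comp.
congr (Defs.Cons _ (Defs.Cons _ (Defs.Cons _ (Defs.Cons _ _)))).
  by congr enc_list; apply: eq_map => p /=; rewrite -map_comp.
by congr enc_list; apply: eq_map => i /=; rewrite -map_comp.
Qed.

Hypothesis I_valid : valid I.
Hypothesis I_acyclic : acyclic (edges I).
Hypothesis I_root : exists r : V, forall p, p \in paths I -> is_endpoint r p.

Let P := paths I.
Let P_uniq p : p \in P -> uniq p.
Proof. by case: I_valid => _ H _ _ _ /H[]. Qed.
Let P_size p : p \in P -> 2 < size p.
Proof. by case: I_valid => _ H _ _ _ /H[]. Qed.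
Let P_cover v : has (fun p => v \in p) P.
Proof. by case: I_valid => _ _ H _ _; apply: H. Qed.
Let tc_ge0 i j : (0 <= tc (i : color I) j)%R.
Proof. by case: I_valid => _ _ _ _ [H _ _]; apply: H. Qed.
Let tcC i j : tc (i : color I) j = tc j i.
Proof. by case: I_valid => _ _ _ _ [_ H _]; apply: H. Qed.

Lemma size_path p : p \in P -> size p <= n.+1.
Proof.
move=> /P_uniq/card_uniqP <-; apply: leq_trans (max_card _) _.
by rewrite card_ord nvert_le.
Qed.

Lemma size_jpath p : p \in jpaths -> size p <= n.+1.
Proof. by case/mapP=> q /size_path le_q ->; rewrite size_map. Qed.

Lemma size_jpaths : size jpaths <= n.+1.
Proof. by rewrite size_map /fuel; lia. Qed.

Lemma is_endpoint_map r p : is_endpoint r p -> is_endpoint (jv r) (map jv p).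
Proof.
rewrite /is_endpoint -map_rev => -[]; [case: p|case: (rev p)] => // x s [->].
  by left.
by right.
Qed.

Lemma rootJ_ex :
  exists2 r : V, rootJ jpaths = jv r & forall p, p \in P -> is_endpoint r p.
Proof.
case: I_root => r0 r0_end; have /hasP[p0 p0P _] := P_cover r0.
have end_root : forall p, p \in jpaths -> is_endpoint (rootJ jpaths) p.
  apply: (@rootJP _ _ (jv r0)); [exact: size_jpaths|exact: size_jpath|].
  by move=> p /mapP[q qP ->]; apply/is_endpoint_map/r0_end.
have ohead_map s y : ohead (map jv s) = Some y ->
    exists2 x, y = jv x & ohead s = Some x.
  by case: s => // x s [<-]; exists x.
have [r eq_r] : exists r, rootJ jpaths = jv r.
  have /end_root : map jv p0 \in jpaths by apply: map_f.
  rewrite /is_endpoint -map_rev => -[] /ohead_map[x -> _]; by exists x.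
exists r => // p pP; have /end_root : map jv p \in jpaths by apply: map_f.
rewrite /is_endpoint -map_rev eq_r.
by case=> /ohead_map[x /jv_inj <-]; [left|right].
Qed.

Section Rooted.
Variable r : V.
Hypothesis r_end : forall p, p \in P -> is_endpoint r p.

Local Notation par := (parent P r).
Local Notation dep := (depth P r).

Lemma jv_cases (y : J) : (exists x, y = jv x) \/ nvert I <= y.
Proof.
have [lt_y|le_y] := ltnP y (nvert I); last by right.
by left; exists (Ordinal lt_y); apply: val_inj.
Qed.

Lemma memJ_map p x : p \in P -> memJ (jv x) (map jv p) = (x \in p).
Proof.
by move=> pP; rewrite memJE ?size_map ?size_path // mem_map //; apply: jv_inj.
Qed.

Lemma startsJ_map p : startsJ (jv r) (map jv p) = starts r p.
Proof. by rewrite startsJE; case: p. Qed.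

Lemma orientJ_map p : p \in P ->
  orientJ (jv r) (map jv p) = map jv (orient r p).
Proof.
move=> pP; rewrite /orientJ startsJ_map /orient; case: ifP => // _.
by rewrite revJE ?size_map ?size_path // map_rev.
Qed.

Lemma parJ_map x : x != r -> parJ jpaths (jv r) (jv x) = jv (par x).
Proof.
move=> x_r; rewrite /parJ lfoldE; last exact: size_jpaths.
apply: foldl_cst => [|q /mapP[p pP ->]].
  have /hasP[p pP xp] := P_cover x.
  by apply/hasP; exists (map jv p); rewrite ?memJ_map ?map_f.
rewrite memJ_map // orientJ_map // => xp.
have xq : x \in orient r p by rewrite mem_orient.
have uq := uniq_orient r P_uniq pP.
rewrite /predJ lfoldE; last first.
  rewrite size_map /orient; case: ifP; rewrite ?size_rev => _; exact: size_path.
under [in LHS]boolp.eq_fun do under boolp.eq_fun do rewrite eqJE.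
rewrite foldl_pred ?(map_inj_uniq jv_inj) ?map_f //.
rewrite index_map; last exact: jv_inj.
rewrite -(pred_in_orient I_acyclic P_uniq r_end P_cover pP xp x_r) /pred_in.
have : 0 < index x (orient r p).
  by rewrite (orientE r_end pP) /= eq_sym (negPf x_r).
move: xq; rewrite -index_mem; case: (index _ _) => // k ltk _ /=.
by rewrite (nth_map r) // ltnW.
Qed.

Lemma ndJ_map x : ndJ (Ordinal nvert_lt) (jv r) (jv x) = (x != r).
Proof. by rewrite /ndJ eqJE (inj_eq jv_inj) -ltnNge /jv /= ltn_ord. Qed.

Lemma ndJ_out (y : J) : nvert I <= y -> ndJ (Ordinal nvert_lt) (jv r) y = false.
Proof. by move=> le_y; rewrite /ndJ le_y. Qed.

Lemma weightJ_map x (c : F) :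
  weightJ pb jpaths (jv r) (jv x) c = weight P r pb x c.
Proof.
have le_P := size_jpaths; have E b p : p \in P ->
    (b (startsJ (jv r) (map jv p)) && memJ (jv x) (map jv p)) =
    (b (starts r p) && (x \in p)).
  by move=> pP; rewrite startsJ_map memJ_map.
rewrite /weightJ /weight; case: pb; rewrite !lfoldE //.
  rewrite foldl_sum addr0 big_map big_seq_cond [RHS]big_seq_cond.
  by apply: eq_bigl => p; case: (boolP (p \in P)) => //= /memJ_map->.
rewrite !foldl_has !orbF !has_map.
rewrite (eq_in_has (a2 := fun p => starts r p && (x \in p))); last
  exact: (E id).
by rewrite [X in (_ + (if X then _ else _))%R]
  (eq_in_has (a2 := fun p => ~~ starts r p && (x \in p)));
  last exact: (E negb).
Qed.

Lemma tcJ_map i j : tcJ jcosts (jc i) (jc j) = tc i j.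
Proof.
have lt k : jc k < size (enum 'I_(ncol I)) by rewrite size_enum_ord /jc /=.
have nthE d k : nth d (enum 'I_(ncol I)) (jc k) = k by exact: nth_ord_enum.
by rewrite /tcJ !nthJE /jcosts (nth_map i) // (nth_map j) ?nthE.
Qed.

Lemma cstJ_ge0 x i j : (0 <= cstJ pb jpaths jcosts (jv r) x i j)%R.
Proof.
have tcJ_ge0 : (0 <= tcJ jcosts i j)%R.
  rewrite /tcJ !nthJE; have [le_j|lt_j] := leqP (size (nth [::] jcosts i)) j.
    by rewrite nth_default.
  have := mem_nth 0%R lt_j; have [le_i|lt_i] := leqP (size jcosts) i.
    by rewrite [nth [::] _ _]nth_default.
  by have /mapP[i' _ ->] := mem_nth [::] lt_i; case/mapP => j' _ ->.
rewrite /cstJ /weightJ; case: ifP => // _; case: pb.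
  rewrite lfoldE; last exact: size_jpaths.
  by rewrite foldl_sum addr0 sumr_ge0.
by rewrite addr_ge0 //; case: ifP.
Qed.

Local Notation nd := (ndJ (Ordinal nvert_lt) (jv r)).
Local Notation parf := (parJ jpaths (jv r)).
Local Notation cols := (colsJ (Ordinal ncol_lt) (jv r)).
Local Notation cst := (cstJ pb jpaths jcosts (jv r)).
Local Notation E := (edges I).

Lemma ndP (y : J) : reflect (exists2 x, x != r & y = jv x) (nd y).
Proof.
apply: (iffP idP) => [nd_y|[x x_r ->]]; last by rewrite ndJ_map.
have [[x eq_y]|le_y] := jv_cases y; last by rewrite ndJ_out in nd_y.
by exists x; rewrite // -ndJ_map -eq_y.
Qed.

Definition unjv (y : J) : option V := insub (val y).

Lemma jvK : pcancel jv unjv.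
Proof. by move=> x; rewrite /unjv /= valK. Qed.

Lemma unjv_out (y : J) : nvert I <= y -> unjv y = None.
Proof. by move=> le_y; rewrite /unjv insubF // ltnNge le_y. Qed.

Definition jdepth (y : J) : nat := if unjv y is Some x then dep x else 0.

Lemma jdepth_le y : jdepth y <= n.
Proof.
rewrite /jdepth; case: (unjv y) => // x.
have := depth_lt I_acyclic P_uniq r_end P_cover x; rewrite card_ord.
by move/ltnW/leq_trans; apply; rewrite /fuel; lia.
Qed.

Lemma jdepth_par y : nd y -> jdepth (parf y) < jdepth y.
Proof.
case/ndP=> x x_r ->; rewrite parJ_map // /jdepth !jvK.
exact: depth_parent I_acyclic P_uniq r_end P_cover _ x_r.
Qed.

Lemma colsE v i j : cols v i j = (j < ncol I) && ((v == jv r) || (j != i)).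
Proof. by rewrite /colsJ !eqJE ltnNge. Qed.

(** A vertex has no more children than the maximum degree, and at most one of the available colors,
    at least one more in number, is forbidden. *)
Lemma enough_cols v i :
  #|[set x | child nd parf v x]| <= #|[set j | cols v i j]|.
Proof.
have [_ _ _ deg_lt _] := I_valid.
apply: (@leq_trans (max_degree E)).
  have [->|[y0]] := set_0Vmem [set x | child nd parf v x].
    by rewrite cards0.
  rewrite inE childE => /andP[/ndP[x0 x0_r ->] /eqP <-]; rewrite parJ_map //.
  apply: leq_trans (leq_bigmax (par x0)).
  have := degree_children I_acyclic P_uniq r_end P_cover (par x0).
  apply: leq_trans; rewrite -(card_imset _ jv_inj); apply: subset_leq_card.
  apply/subsetP => y; rewrite inE childE => /andP[/ndP[x x_r ->]].
  rewrite parJ_map // (inj_eq jv_inj) => eq_par.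
  by apply: imset_f; rewrite inE x_r.
apply: (@leq_trans #|(jc @: setT) :\ i|).
  have := cardsD1 i (jc @: setT); rewrite (card_imset _ jc_inj) cardsT card_ord.
  by move: deg_lt; case: (i \in _) => /=; lia.
apply: subset_leq_card; apply/subsetP => j; rewrite !inE colsE.
by case/andP=> -> /imsetP[k _ ->]; rewrite orbT andbT /jc /=.
Qed.

(** The color of an edge moves to its lower endpoint; the value [ord0] elsewhere is the one that
    [colors_optimal] prescribes. *)
Definition vertex_coloring (chi : coloring I) (y : J) : J :=
  if unjv y is Some x then if x == r then ord0 else jc (chi (pedge P r x))
  else ord0.

Lemma vertex_coloring_jv chi x :
  x != r -> vertex_coloring chi (jv x) = jc (chi (pedge P r x)).
Proof. by move=> /negPf x_r; rewrite /vertex_coloring jvK x_r. Qed.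

Lemma vertex_coloring_out chi y : ~~ nd y -> vertex_coloring chi y = ord0.
Proof.
have [[x ->]|le_y] := jv_cases y; last by rewrite /vertex_coloring unjv_out.
by rewrite ndJ_map negbK /vertex_coloring jvK => ->.
Qed.

Lemma feasible_coloring chi :
  feasible nd parf cols (vertex_coloring chi) <-> Defs.proper E chi.
Proof.
have proper_r := proper_star I_acyclic P_uniq r_end P_cover chi.
rewrite {}proper_r; split=> -[H1 H2]; split.
- move=> x x_r px_r; have /H1 : nd (jv x) by rewrite ndJ_map.
  rewrite parJ_map // colsE !vertex_coloring_jv // (inj_eq jv_inj) (negPf px_r).
  by move=> /andP[_ /= /eqP neq] eq_chi; apply: neq; rewrite eq_chi.
- move=> x y x_r y_r eq_par eq_chi; apply: jv_inj; apply: H2.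
  + by rewrite ndJ_map.
  + by rewrite ndJ_map.
  + by rewrite !parJ_map // eq_par.
  + by rewrite !vertex_coloring_jv // eq_chi.
- move=> y /ndP[x x_r ->]; rewrite parJ_map // colsE (vertex_coloring_jv _ x_r).
  rewrite /jc /= ltn_ord (inj_eq jv_inj) /=.
  have [//|px_r] := eqVneq (par x) r; rewrite vertex_coloring_jv //=.
  by apply/eqP => /jc_inj /esym; apply: H1.
- move=> y z /ndP[x x_r ->] /ndP[x' x'_r ->]; rewrite !parJ_map //.
  rewrite !vertex_coloring_jv // => /jv_inj eq_par /jc_inj eq_chi.
  by congr jv; apply: H2.
Qed.

Lemma total_coloring chi :
  total_cost nd parf cst (vertex_coloring chi) = cost pb chi.
Proof.
transitivity (\sum_(x | inner P r x) weight P r pb x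
    (tcost chi (pedge P r (par x), pedge P r x)))%R.
  rewrite /total_cost.
  rewrite (eq_bigl (mem (jv @: [set x | x != r]))); last first.
    move=> y; apply/ndP/imsetP => -[x]; rewrite ?inE; exists x => //.
    by rewrite inE.
  rewrite big_imset /=; last by move=> ? ? _ _; apply: jv_inj.
  rewrite /inner [RHS]big_mkcondr /=.
  apply: eq_big => [x|x]; rewrite inE // => x_r.
  rewrite parJ_map // /cstJ parJ_map // eqJE (inj_eq jv_inj).
  have [//|px_r] := eqVneq (par x) r.
  by rewrite !vertex_coloring_jv // tcJ_map weightJ_map.
have swapE t : tcost chi (swap t) = tcost chi t by rewrite /tcost /= tcC.
rewrite /weight /cost; case: pb.
  by rewrite /reload_cost (sum_reload I_acyclic P_uniq P_size r_end P_cover).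
by rewrite /changeover_cost
  (sum_changeover I_acyclic P_uniq P_size r_end P_cover).
Qed.

Local Notation kap := (colors nd parf cols cst).

Lemma ncol_gt0 : 0 < ncol I.
Proof. by have [_ _ _ + _] := I_valid; rewrite addn1; apply: leq_trans. Qed.

(** The inverse passage; [c0] fills in for sets that are not edges, and [kap_feasible] keeps the
    colors of edges in range. *)
Definition solution (e : {set V}) : color I :=
  let c0 := Ordinal ncol_gt0 in
  if [pick x | (x != r) && (e == pedge P r x)] is Some x
  then insubd c0 (val (kap (jv x))) else c0.

Lemma kap_feasible : feasible nd parf cols kap.
Proof.
exact: (colors_feasible jdepth_le jdepth_par cstJ_ge0 enough_cols).
Qed.

Lemma solution_pedge x :
  x != r -> val (solution (pedge P r x)) = val (kap (jv x)).
Proof.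
move=> x_r; rewrite /solution; case: pickP => [y /andP[y_r /eqP eq_xy]|].
  have <- := pedge_inj I_acyclic P_uniq r_end P_cover x_r y_r eq_xy.
  have [/(_ (jv x)) + _] := kap_feasible; rewrite ndJ_map x_r => /(_ isT).
  rewrite colsE => /andP[lt_kap _].
  by rewrite val_insubd lt_kap.
by move=> /(_ x); rewrite x_r eqxx.
Qed.

Lemma vertex_coloring_solution : vertex_coloring solution = kap.
Proof.
apply: boolp.funext => y; have [|nd_y] := boolP (nd y).
  case/ndP=> x x_r ->; rewrite vertex_coloring_jv //; apply: val_inj.
  by rewrite -solution_pedge.
rewrite vertex_coloring_out //.
by rewrite (colors_fix _ _ jdepth_le jdepth_par) (negPf nd_y).
Qed.

Lemma solution_optimal : optimal pb solution.
Proof.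
have kap_f := kap_feasible; rewrite -vertex_coloring_solution in kap_f.
split; first exact/feasible_coloring.
move=> chi /feasible_coloring chi_f.
rewrite -!total_coloring vertex_coloring_solution.
apply: (colors_optimal jdepth_le jdepth_par cstJ_ge0 enough_cols) => // y.
exact: vertex_coloring_out.
Qed.

Lemma encodes_solution :
  encodes_coloring (@vof F n TOutput (outJ nd parf kap)) solution.
Proof.
have unjvK : ocancel unjv jv.
  move=> y; have [[x ->]|le_y] := jv_cases y; first by rewrite jvK.
  by rewrite unjv_out.
pose vs := [seq x <- pmap unjv (enum J) | x != r].
exists [seq (par x, x) | x <- vs].
have -> : [seq [set uv.1; uv.2] | uv <- [seq (par x, x) | x <- vs]] =
    map (pedge P r) vs by rewrite -map_comp.
split.
- rewrite map_inj_in_uniq ?filter_uniq ?(pmap_uniq unjvK) ?enum_uniq //.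
  move=> x y; rewrite !mem_filter => /andP[x_r _] /andP[y_r _].
  exact: pedge_inj.
- move=> e; apply/mapP/(edgesP I_acyclic P_uniq r_end P_cover) => -[x].
    by rewrite mem_filter => /andP[x_r _] ->; exists x.
  move=> x_r ->; exists x => //; rewrite mem_filter x_r mem_pmap -(jvK x).
  by rewrite map_f // mem_enum.
- rewrite /= /vs /outJ -map_comp; congr enc_list.
  elim: (enum J) => //= y l IHl; have [[x ->]|le_y] := jv_cases y; last first.
    by rewrite ndJ_out // unjv_out.
  rewrite jvK /= ndJ_map; case: ifP => //= x_r; rewrite IHl; congr (_ :: _).
  rewrite parJ_map ?x_r //= -[[set par x; x]]/(pedge P r x).
  by rewrite solution_pedge ?x_r.
Qed.

End Rooted.

Lemma solveP : exists2 chi : coloring I,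
  encodes_coloring (@vof F n TOutput (solve pb input)) chi & optimal pb chi.
Proof.
have [r eq_r r_end] := rootJ_ex; exists (solution r).
  by rewrite /solve /= eq_r; apply: encodes_solution.
exact: solution_optimal.
Qed.

End Instance.

(** * Running time *)

(** Adds the length of a list to the unary fuel in variable 0. Starting from 1 and counting
    vertices, colors and paths gives [(fuel I).+1]. *)
Definition count_cmd (e : expr) : cmd :=
  Seq (Assign 2 e)
    (While (EVar 2) (Seq (Assign 0 (ECons ENil (EVar 0)))
                         (Assign 2 (ETl (EVar 2))))).

Definition solve_cmd (pb : problem) : cmd :=
  Seq (Assign 1 (EVar 0))
 (Seq (Assign 0 (ECons ENil ENil))
 (Seq (count_cmd (EHd (EVar 1)))
 (Seq (count_cmd (EHd (ETl (EVar 1))))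
 (Seq (count_cmd (EHd (ETl (ETl (EVar 1)))))
 (Seq (compile (t_solve pb) 1)
      (Assign 0 (EVar 1))))))).

Lemma wp_count (F : numDomainType) e l k (s : store F) :
  eval s e = enc_list l -> s 0 = enc_nat F k ->
  ecost (@unit_length F) s e < 10 ->
  wp (count_cmd e) (size l * 10 + 20)
    (fun s' => s' 0 = enc_nat F (size l + k) /\ s' 1 = s 1) s.
Proof.
move=> se s0 cost_e; apply: (@wp_seq _ _ _ 10 (size l * 10 + 2)); first by lia.
apply: wp_assign => //; rewrite se.
pose Inv m (s' : store F) := exists l', [/\ size l' = m, s' 2 = enc_list l',
  s' 0 = enc_nat F (size l - m + k) & m <= size l /\ s' 1 = s 1].
apply: (@wp_weaken _ _ (size l * 10).+2 _ (Inv 0)); last 2 first.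
- by lia.
- by move=> s' [l' [_ _ -> [_ ->]]]; rewrite subn0.
apply: wp_while; last first.
- by exists l; rewrite subnn.
- move=> m s' [[|a l'] [size_l' s'2 s'0 [lem s'1]]] //.
  case: size_l' => size_l'; rewrite s'2; split=> //.
  apply: (@wp_seq _ _ _ 4 3) => //; apply: wp_assign => //=.
  apply: wp_assign => //=; exists l'; rewrite /upd /= s'2 s'0 s'1.
  split=> //; last by split=> //; lia.
  have -> : size l - m + k = (size l - m.+1 + k).+1 by move: lem; clear; lia.
  by [].
- by move=> s' [l' [/size0nil-> -> _ _]].
Qed.

Lemma run_solve (F : realDomainType) pb : exists2 b, poly_bounded b &
  forall I : instance F, exists t,
    run (@unit_length F) (solve_cmd pb) (enc_instance I) t
      (@vof F (fuel I) TOutput (solve pb (input I))) /\ t <= b (fuel I).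
Proof.
have [b pb_b Hb] := compile_correct F (t_solve pb).
exists (fun n => b n + n * 10 + 100).
  apply: poly_boundedD (poly_bounded_cst _); apply: poly_boundedD => //.
  exact: poly_boundedM poly_bounded_id (poly_bounded_cst _).
move=> I; set n := fuel I; set s := input_store (enc_instance I).
suff [t [s' [ex le_t eq_s']]] : wp (solve_cmd pb) (b n + n * 10 + 100)
    (fun s' => s' 0 = @vof F n TOutput (solve pb (input I))) s.
  by exists t; split=> //; exists s'.
have n_eq : n = nvert I + ncol I + size (paths I) by [].
apply: (@wp_seq _ _ _ 2 (b n + n * 10 + 90)); first by lia.
apply: wp_assign => //=.
apply: (@wp_seq _ _ _ 4 (b n + n * 10 + 80)); first by lia.
apply: wp_assign => //=.
set s0 := upd _ _ _.
have s01 : s0 1 = vof (input I) by rewrite vof_input.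
apply: (@wp_seq _ _ _ (nvert I * 10 + 20)
  (b n + (ncol I + size (paths I)) * 10 + 55)); first by lia.
apply: (@wp_weaken _ _ (size (nseq (nvert I) (@Defs.Nil F)) * 10 + 20)).
- by apply: (@wp_count _ _ (nseq (nvert I) Defs.Nil) 1).
- by rewrite size_nseq.
move=> s1 [s10 s11].
apply: (@wp_seq _ _ _ (ncol I * 10 + 20) (b n + size (paths I) * 10 + 30)).
  by lia.
apply: (@wp_weaken _ _ (size (nseq (ncol I) (@Defs.Nil F)) * 10 + 20)).
- apply: (@wp_count _ _ (nseq (ncol I) Defs.Nil) _ _ _ s10) => //=.
  by rewrite s11 s01.
- by rewrite size_nseq.
move=> s2 [s20 s21].
apply: (@wp_seq _ _ _ (size (paths I) * 10 + 20) (b n + 5)); first by lia.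
pose ps := [seq @vof F n (TList TIdx) x | x <- jpaths I].
apply: (@wp_weaken _ _ (size ps * 10 + 20)).
- apply: (@wp_count _ _ ps _ _ _ s20) => //=.
  by rewrite s21 s11 s01.
- by rewrite /ps !size_map.
move=> s3 [s30 s31].
apply: (@wp_seq _ _ _ (b n) 2); first by lia.
apply: (@wp_call _ n 1 _ _ (t_solve pb) (input I)) => //.
- rewrite s30 /ps !size_map !size_nseq; congr enc_nat; lia.
- by rewrite s31 s21 s11.
move=> s4; rewrite t_solveE => s41 _; apply: wp_assign; first by [].
by rewrite updE eqxx; apply: s41.
Qed.

Lemma poly_bounded_poly f : poly_bounded f ->
  exists p : {poly nat}, forall m n, m <= n -> f m <= p.[n]%R.
Proof.
case=> k fk; exists (('X + 2%:P) ^+ k)%R => m n le_mn.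
rewrite horner_exp hornerD hornerX hornerC.
apply: leq_trans (fk m) _; case: k {fk} => // k.
by rewrite leq_exp2r // leq_add2r.
Qed.

Lemma leq_fuel (F : numDomainType) (w : F -> nat) (I : instance F) :
  valid I -> fuel I <= instance_size w I.
Proof.
move=> [_ P_size _ _ _]; rewrite /fuel /instance_size.
have : size (paths I) <= \sum_(p <- paths I) size p; last by lia.
rewrite -sum1_size big_seq [leqRHS]big_seq; apply: leq_sum => p /P_size[_].
exact: leq_trans.
Qed.

Lemma poly_time_unit_cost (R : realType) (pb : problem) :
  poly_time_solvable (F := R) (@unit_length R) pb (@rooted_tree R).
Proof.
have [b /poly_bounded_poly[p bp] Hb] := run_solve R pb.
exists (solve_cmd pb), p => I I_valid [[_ _ I_acyclic] I_root].
have [chi enc_chi opt_chi] := solveP pb I_valid I_acyclic I_root.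
have [t [run_t le_t]] := Hb I.
exists t, (vof (A := TOutput) (solve pb (input I))), chi; split=> //.
by apply: leq_trans le_t _; apply/bp/leq_fuel.
Qed.

(** * Bit cost on rational inputs *)

Lemma all_nums_map (F : numDomainType) (P : F -> Prop) (T : Type)
    (f : T -> value F) l :
  (forall x, all_nums P (f x)) -> all_nums P (enc_list (map f l)).
Proof. by move=> Pf; elim: l => //= x l IHl; split. Qed.

Lemma all_nums_enc_nat (F : numDomainType) (P : F -> Prop) m :
  all_nums P (enc_nat F m).
Proof. by elim: m => //= m IHm; split. Qed.

(** The product of all denominators has a length bounded by the sum of theirs, hence by the size of
    the instance. *)
Definition common_den (I : instance rat) : nat :=
  \prod_(i : color I) \prod_(j : color I) `|denq (tc i j)|.

Lemma common_den_gt0 I : 0 < common_den I.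
Proof.
by do 2![apply: prodn_gt0 => ?]; rewrite absz_gt0 denq_eq0.
Qed.

Lemma expn_sum (J : finType) (f : J -> nat) :
  2 ^ (\sum_j f j) = \prod_j 2 ^ f j.
Proof. by rewrite (big_morph _ (expnD 2) (expn0 2)). Qed.

Lemma common_den_le I : common_den I <= 2 ^ instance_size rat_bits I.
Proof.
apply: (@leq_trans (2 ^ (\sum_(i : color I) \sum_(j : color I)
    (rat_bits (tc i j)).+1))); last first.
  by rewrite leq_exp2l // /instance_size leq_addl.
rewrite expn_sum; apply: leq_prod => i _; rewrite expn_sum.
apply: leq_prod => j _; apply: leq_trans (ltnW (nat_bits_gt _)) _.
by rewrite leq_exp2l // /rat_bits; lia.
Qed.

Lemma tc_frac (I : instance rat) (i j : color I) :
  frac_le (common_den I) (2 * instance_size rat_bits I) (tc i j).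
Proof.
set D := common_den I; set q := tc i j.
have D0 : (D%:R : rat) != 0%R by rewrite pnatr_eq0 -lt0n common_den_gt0.
have dvd : `|denq q| %| D.
  rewrite /D /common_den (bigD1 i) //= dvdn_mulr // (bigD1 j) //=.
  exact: dvdn_mulr.
exists (numq q * (D %/ `|denq q|)%:Z)%R.
  apply: (mulIf D0); rewrite divfK // intrM numqE -[in LHS](divnK dvd) natrM.
  by rewrite -pmulrn [`|_|%:R%R]pmulrn absz_denq mulrCA mulrA [RHS]mulrC mulrA.
(* One factor [2 ^ N], with N the instance size, bounds the numerator of the cost, the other its
   scaling up to the common denominator. *)
rewrite abszM /= mul2n -addnn expnD; apply: leq_mul; last first.
  exact: leq_trans (leq_div _ _) (common_den_le I).
apply: leq_trans (ltnW (nat_bits_gt _)) _; rewrite leq_exp2l //.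
rewrite /instance_size (bigD1 i) //= (bigD1 j) //= -/q /rat_bits.
lia.
Qed.

Lemma all_nums_input (F : numDomainType) (I : instance F) (P : F -> Prop) :
  (forall i j : color I, P (tc i j)) -> all_nums P (enc_instance I).
Proof.
move=> Ptc; split; [|split; [|split; [|split]]] => //.
- exact: all_nums_enc_nat.
- exact: all_nums_enc_nat.
- by do 2![apply: all_nums_map => ?]; apply: all_nums_enc_nat.
- by do 2![apply: all_nums_map => ?]; apply: Ptc.
Qed.

Lemma poly_time_bit_cost (pb : problem) :
  poly_time_solvable (F := rat) rat_bits pb (@rooted_tree rat).
Proof.
have [b pb_b Hb] := run_solve rat pb; have [k bk] := pb_b.
pose T n := (n + 2) ^ k.
have /poly_bounded_poly[p Tp] :
    poly_bounded (fun n => T n * (2 * (3 * n + T n + 3) + 1)).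
  have pT : poly_bounded T by exists k.
  apply: poly_boundedM => //; apply: poly_boundedD (poly_bounded_cst _).
  apply: poly_boundedM (poly_bounded_cst _) _.
  apply: poly_boundedD (poly_bounded_cst _); apply: poly_boundedD => //.
  exact: poly_boundedM (poly_bounded_cst _) poly_bounded_id.
exists (solve_cmd pb), p => I I_valid [[_ _ I_acyclic] I_root].
have [chi enc_chi opt_chi] := solveP pb I_valid I_acyclic I_root.
have [t [[s [ex s_out]] le_t]] := Hb I.
set N := instance_size rat_bits I; set D := common_den I.
have le_tN : t <= T N.
  apply: leq_trans le_t _; apply: leq_trans (bk _) _; rewrite /T.
  by case: (k) => // m; rewrite leq_exp2r // leq_add2r; apply: leq_fuel.
(* Numerators start with at most 2N bits and gain at most [T N]; the common denominator adds N. *)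
have bits q : frac_le D (2 * N + T N) q -> rat_bits q <= 3 * N + T N + 3.
  move=> /(rat_bits_frac (common_den_gt0 I) (common_den_le I)).
  by rewrite -/N; lia.
have init x : all_nums (frac_le D (2 * N)) (input_store (enc_instance I) x).
  rewrite /input_store; case: eqP => // _; apply: all_nums_input => i j.
  exact: tc_frac.
have le_level : 2 * N + t <= 2 * N + T N by rewrite leq_add2l.
have [_ [t' ex' le_t']] := exec_transfer (@frac_le_mono D) (frac_le0 D)
  (@frac_leD D) (@frac_leB D) bits ex init le_level.
exists t', (vof (A := TOutput) (solve pb (input I))), chi; split=> //.
  by exists s.
apply: leq_trans le_t' _; apply: leq_trans (Tp N N (leqnn N)).
by rewrite leq_mul2r le_tN orbT.
Qed.

(* Polynomial time for arbitrary real costs (unit-cost real arithmetic) and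
   for rational costs (bit complexity). *)
Theorem theorem5 :
  (forall (R : realType) (pb : problem),
     poly_time_solvable (F := R) (@unit_length R) pb (@rooted_tree R))
  /\
  (forall pb : problem,
     poly_time_solvable (F := rat) rat_bits pb (@rooted_tree rat)).
Proof. by split; [exact: poly_time_unit_cost|exact: poly_time_bit_cost]. Qed.
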